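(* Let $V_\lambda$ be the irreducible representation of $\mathfrak u_n\otimes\mathbb C$ of highest weight $\lambda$. The matrix coefficients $\tau_{-\varepsilon,+\tilde\varepsilon}$ and $\tau_{+\varepsilon,-\tilde\varepsilon}$ of the twist operator $\tau$ in the basis $\{\mathrm{pr}_\varepsilon\}$ of $\mathfrak W(V_\lambda)$, defined by $$\tau\,\mathrm{pr}_{-\varepsilon}=\sum_{+\tilde\varepsilon}\tau_{-\varepsilon,+\tilde\varepsilon}\,\mathrm{pr}_{+\tilde\varepsilon},\qquad \tau\,\mathrm{pr}_{+\varepsilon}=\sum_{-\tilde\varepsilon}\tau_{+\varepsilon,-\tilde\varepsilon}\,\mathrm{pr}_{-\tilde\varepsilon},$$ where $-\varepsilon,-\tilde\varepsilon$ run over the relevant holomorphic weights and $+\varepsilon,+\tilde\varepsilon$ over the relevant antiholomorphic weights, are given by $$\tau_{-\varepsilon,+\tilde\varepsilon}=\frac{1}{b_{-\varepsilon}+b_{+\tilde\varepsilon}+n}\,\frac{\dim V_{\lambda-\varepsilon}}{\dim V_\lambda},\qquad \tau_{+\varepsilon,-\tilde\varepsilon}=\frac{1}{b_{+\varepsilon}+b_{-\tilde\varepsilon}+n}\,\frac{\dim V_{\lambda+\varepsilon}}{\dim V_\lambda}.$$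
   Context: Kähler holonomy: $\mathfrak g_{\mathbb R}=\mathfrak u_n$ acts on $T_{\mathbb R}=\mathbb C^n=\mathbb R^{2n}$, $\mathfrak g=\mathfrak u_n\otimes_{\mathbb R}\mathbb C$, $T=T_{\mathbb R}\otimes_{\mathbb R}\mathbb C=T^{1,0}\oplus T^{0,1}$ with the $\mathbb C$-bilinear extension $\langle\cdot,\cdot\rangle$ of the scalar product. For a maximal torus $\mathfrak t$, the weights of $T^{1,0}$ are $+\varepsilon_1,\dots,+\varepsilon_n$ (called antiholomorphic) and those of $T^{0,1}$ are $-\varepsilon_1,\dots,-\varepsilon_n$ (called holomorphic); $\varepsilon_1,\dots,\varepsilon_n$ is an orthonormal basis of $\mathfrak t^*$. Highest weights are $\lambda=\mu_1\varepsilon_1+\dots+\mu_n\varepsilon_n$ with integers $\mu_1\ge\dots\ge\mu_n$. A weight $\varepsilon$ of $T$ is relevant for $\lambda$ (written $\varepsilon\subset\lambda$) if $V_{\lambda+\varepsilon}$ occurs in $T\otimes V_\lambda$, equivalently if $\lambda+\varepsilon$ is dominant; $T\otimes V_\lambda=\bigoplus_{\varepsilon\subset\lambda}V_{\lambda+\varepsilon}$ is multiplicity free and $\mathrm{pr}_\varepsilon$ denotes the invariant projection onto $V_{\lambda+\varepsilon}$. $\mathfrak W(V_\lambda)=\mathrm{Hom}_{\mathfrak g}(T\otimes T,\mathrm{End}\,V_\lambda)=\mathrm{End}_{\mathfrak g}(T\otimes V_\lambda)$, where $F(b\otimes v)=\sum_\mu t_\mu\otimes F_{t_\mu\otimes b}v$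 for an orthonormal basis $\{t_\mu\}$ of $T$; the $\mathrm{pr}_\varepsilon$, $\varepsilon\subset\lambda$, form a basis. The twist $\tau:\mathfrak W(V_\lambda)\to\mathfrak W(V_\lambda)$ is $\tau(F)_{a\otimes b}=F_{b\otimes a}$; it interchanges the span of the $\mathrm{pr}_\varepsilon$ for relevant holomorphic $\varepsilon$ with the span for relevant antiholomorphic $\varepsilon$. The numbers $b_\varepsilon$ are the eigenvalues on $V_{\lambda+\varepsilon}$ of the conformal weight operator $B=-\sum_\alpha X_\alpha\otimes X_\alpha\in\mathrm{End}_{\mathfrak g}(T\otimes V_\lambda)$, where $\{X_\alpha\}$ is a basis of $\mathfrak g$ orthonormal for $\langle X,Y\rangle=-\frac12\mathrm{tr}_T(XY)$; explicitly $b_{-\varepsilon_k}=-\mu_k+k-n$ and $b_{+\varepsilon_k}=\mu_k-k+1$. *)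

(* Defs.v *)
From HB Require Import structures.
From mathcomp Require Import all_boot all_order all_algebra.
From mathcomp Require Import ring.
From mathcomp Require Export boolp reals complex mxtens.

Set Implicit Arguments.
Unset Strict Implicit.
Unset Printing Implicit Defensive.

Import GRing.Theory Num.Theory.
Local Open Scope ring_scope.

Definition lie_bracket (K : pzRingType) (d : nat) (X Y : 'M[K]_d) : 'M[K]_d :=
  X *m Y - Y *m X.

(* The complex Lie algebra g = u_n (x)_R C is realised as 'M[R[i]]_n = gl_n(C):
   every complex matrix Z is uniquely X + i Y with X and Y skew-hermitian
   (skew_part and iskew_part below).  Representations of g are complex-linear
   and act on column vectors. *)
Record glrep (R : realType) (n : nat) := GlRep {
  rdim : nat;
  ract :> {linear 'M[R[i]]_n -> 'M[R[i]]_rdim};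
  ract_bracket : forall X Y,
    ract (lie_bracket X Y) = lie_bracket (ract X) (ract Y) }.

Section HighestWeight.

Variables (R : realType) (n : nat).
Implicit Types (V : glrep R n) (kappa : 'rV[int]_n).

(* Weights with respect to the diagonal maximal torus: the row kappa stands for
   sum_k kappa_k eps_k, where eps_k reads off the k-th diagonal entry. *)
Definition eps (k : 'I_n) : 'rV[int]_n := delta_mx 0 k.

Definition dominant kappa :=
  forall i j : 'I_n, (i <= j)%N -> kappa 0 j <= kappa 0 i.

Definition weight_vector V kappa (v : 'cV[R[i]]_(rdim V)) :=
  v != 0 /\
  forall k, V (delta_mx k k) *m v = (kappa 0 k)%:~R *: v.

Definition is_weight V kappa := exists v, weight_vector (V := V) kappa v.

(* The positive roots are eps_i - eps_j for i < j, with root vectors E_ij. *)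
Definition highest_weight_vector V kappa (v : 'cV[R[i]]_(rdim V)) :=
  weight_vector kappa v /\
  forall i j : 'I_n, (i < j)%N -> V (delta_mx i j) *m v = 0.

Definition submodule V (U : {vspace 'cV[R[i]]_(rdim V)}) :=
  forall Z v, v \in U -> V Z *m v \in U.

Definition irreducible_submodule V (U : {vspace 'cV[R[i]]_(rdim V)}) :=
  [/\ submodule U, U != 0%VS &
      forall U', submodule U' -> (U' <= U)%VS -> U' = 0%VS \/ U' = U].

(* U is a copy of the irreducible module V_kappa inside V. *)
Definition hw_submodule V kappa (U : {vspace 'cV[R[i]]_(rdim V)}) :=
  irreducible_submodule U /\
  exists2 v, v \in U & highest_weight_vector kappa v.

(* V itself is an irreducible module V_kappa. *)
Definition hw_module V kappa := hw_submodule kappa (fullv : {vspace 'cV_(rdim V)}).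

Definition occurs V kappa := exists U, hw_submodule (V := V) kappa U.

Definition equivariant V (P : 'M[R[i]]_(rdim V)) :=
  forall Z, P *m V Z = V Z *m P.

Definition invariant_projection V kappa (P : 'M[R[i]]_(rdim V)) :=
  equivariant P /\
  exists2 U, hw_submodule kappa U &
    (forall v, P *m v \in U) /\ (forall u, u \in U -> P *m u = u).

End HighestWeight.

Section Tensor.

Variables (R : realType) (n : nat) (V W : glrep R n).

Definition tens_act (Z : 'M[R[i]]_n) : 'M[R[i]]_(rdim V * rdim W) :=
  V Z *t 1%:M + 1%:M *t W Z.

Let tensDl m p q r (A A' : 'M[R[i]]_(m, p)) (B : 'M[R[i]]_(q, r)) :
  (A + A') *t B = A *t B + A' *t B.
Proof. by apply/matrixP => i j; rewrite !mxE mulrDl. Qed.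

Let tensDr m p q r (A : 'M[R[i]]_(m, p)) (B B' : 'M[R[i]]_(q, r)) :
  A *t (B + B') = A *t B + A *t B'.
Proof. by apply/matrixP => i j; rewrite !mxE mulrDr. Qed.

Let tensNl m p q r (A : 'M[R[i]]_(m, p)) (B : 'M[R[i]]_(q, r)) :
  (- A) *t B = - (A *t B).
Proof. by apply/matrixP => i j; rewrite !mxE mulNr. Qed.

Let tensNr m p q r (A : 'M[R[i]]_(m, p)) (B : 'M[R[i]]_(q, r)) :
  A *t (- B) = - (A *t B).
Proof. by apply/matrixP => i j; rewrite !mxE mulrN. Qed.

Fact tens_act_is_linear : linear tens_act.
Proof.
move=> a X Y; rewrite /tens_act !linearP.
by apply/matrixP => i j; rewrite !mxE; ring.
Qed.

HB.instance Definition _ := GRing.isLinear.Build R[i] 'M[R[i]]_n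
  'M[R[i]]_(rdim V * rdim W) *:%R tens_act tens_act_is_linear.

Fact tens_act_bracket X Y :
  tens_act (lie_bracket X Y) = lie_bracket (tens_act X) (tens_act Y).
Proof.
rewrite /tens_act !ract_bracket /lie_bracket !tensDl !tensDr !tensNl !tensNr.
rewrite !mulmxDl !mulmxDr !tensmx_mul !mulmx1 !mul1mx.
by apply/matrixP => i j; rewrite !mxE; ring.
Qed.

Definition tens_rep : glrep R n := GlRep tens_act_bracket.

End Tensor.

Section Blocks.

Variables (K : fieldType) (n : nat).
Implicit Types P Q : 'M[K]_n.

Lemma add_scale_block (a : K) P P' Q Q' A B :
  P + a *: P' = A -> Q + a *: Q' = B ->
  block_mx P (- Q) Q P + a *: block_mx P' (- Q') Q' P' = block_mx A (- B) B A.
Proof.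
by move=> <- <-; rewrite scale_block_mx add_block_mx scalerN -opprD.
Qed.

Lemma block_bracket (h c : K) (X Y : 'M[K]_n) :
  h = 2 * (h * h) -> c = 2 * (c * h) -> c * c = - (h * h) ->
  let blk Z := block_mx (h *: (Z - Z^T)) (- (c *: (Z + Z^T)))
                        (c *: (Z + Z^T)) (h *: (Z - Z^T)) in
  blk (lie_bracket X Y) = lie_bracket (blk X) (blk Y).
Proof.
move=> hE cE ccE blk; rewrite /blk /lie_bracket !mulmx_block opp_block_mx.
rewrite add_block_mx [(_ - _)^T]linearB /= !trmx_mul.
rewrite !(mulNmx, mulmxN) -!scalemxAl -!scalemxAr !scalerA ccE.
rewrite !(mulmxBl, mulmxBr, mulmxDl, mulmxDr).
have sub (x y : 'M[K]_n) i j : (x - y) i j = x i j - y i j.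
  by rewrite mxE [(- y) i j]mxE.
have addE (x y : 'M[K]_n) i j : (x + y) i j = x i j + y i j by rewrite mxE.
have opp (x : 'M[K]_n) i j : (- x) i j = - x i j by rewrite mxE.
have scl a (x : 'M[K]_n) i j : (a *: x) i j = a * x i j by rewrite mxE.
move: (X *m Y) (Y *m X) (X *m Y^T) (Y *m X^T) (X^T *m Y) (Y^T *m X)
  (X^T *m Y^T) (Y^T *m X^T) => p1 p2 p3 p4 p5 p6 p7 p8.
congr block_mx; apply/matrixP => i j; rewrite !(sub, addE, opp, scl).
- by rewrite [X in X * _ = _]hE; ring.
- by rewrite [X in - (X * _) = _]cE; ring.
- by rewrite [X in X * _ = _]cE; ring.
- by rewrite [X in X * _ = _]hE; ring.
Qed.

End Blocks.

Section Tangent.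

Variables (R : realType) (n : nat).
Implicit Types Z : 'M[R[i]]_n.

Definition adjmx Z : 'M[R[i]]_n := (map_mx (@conjc R) Z)^T.

(* u_n acting on T_R = C^n = R^(2n), the vector x + i y of C^n being the
   column (x, y) of R^(2n). *)
Definition unitary_act (X : 'M[R[i]]_n) : 'M[R]_(n + n) :=
  block_mx (map_mx (@complex.Re R) X) (- map_mx (@complex.Im R) X)
           (map_mx (@complex.Im R) X) (map_mx (@complex.Re R) X).

(* Z = skew_part Z + i * iskew_part Z with both parts in u_n. *)
Definition skew_part Z := 2^-1 *: (Z - adjmx Z).
Definition iskew_part Z := (2 * 'i%C)^-1 *: (Z + adjmx Z).

(* The action of g on T = T_R (x) C = C^(2n), extended complex-linearly from
   that of u_n; the extended scalar product is a^T *m b, for which the standard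
   basis is orthonormal. *)
Definition tangent_act Z : 'M[R[i]]_(n + n) :=
  map_mx (real_complex R) (unitary_act (skew_part Z)) +
  'i%C *: map_mx (real_complex R) (unitary_act (iskew_part Z)).

Let map_unitary_block X : map_mx (real_complex R) (unitary_act X) =
  block_mx (map_mx (real_complex R) (map_mx (@complex.Re R) X))
           (- map_mx (real_complex R) (map_mx (@complex.Im R) X))
           (map_mx (real_complex R) (map_mx (@complex.Im R) X))
           (map_mx (real_complex R) (map_mx (@complex.Re R) X)).
Proof. by rewrite /unitary_act map_block_mx map_mxN. Qed.

Lemma tangent_actE Z :
  tangent_act Z =
  block_mx (2^-1 *: (Z - Z^T)) (- ((2 * 'i%C)^-1 *: (Z + Z^T)))
           ((2 * 'i%C)^-1 *: (Z + Z^T)) (2^-1 *: (Z - Z^T)).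
Proof.
have twoV : 2^-1 = (2^-1)%:C%C :> R[i].
  by rewrite (fmorphV (real_complex R)) rmorph_nat.
have itwoV : (2 * 'i%C)^-1 = Complex 0 (- 2^-1) :> R[i].
  have two0 : (2 : R[i]) != 0 by rewrite pnatr_eq0.
  have iu : 2 * 'i%C != 0 :> R[i].
    by rewrite mulf_neq0 // eq_complex /= oner_eq0 andbF.
  apply: (mulfI iu); rewrite divff //.
  rewrite -(rmorph_nat (real_complex R)); apply/eqP; rewrite eq_complex /=.
  by apply/andP; split; apply/eqP; field.
have ReE (z w : R[i]) :
    (complex.Re (2^-1 * (z - conjc w)))%:C%C +
    'i%C * (complex.Re ((2 * 'i%C)^-1 * (z + conjc w)))%:C%C = 2^-1 * (z - w).
  rewrite itwoV twoV; case: z w => a b [c d].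
  apply/eqP; rewrite eq_complex /=.
  by apply/andP; split; apply/eqP; field.
have ImE (z w : R[i]) :
    (complex.Im (2^-1 * (z - conjc w)))%:C%C +
    'i%C * (complex.Im ((2 * 'i%C)^-1 * (z + conjc w)))%:C%C =
    (2 * 'i%C)^-1 * (z + w).
  rewrite itwoV twoV; case: z w => a b [c d].
  apply/eqP; rewrite eq_complex /=.
  by apply/andP; split; apply/eqP; field.
have ReP : map_mx (real_complex R) (map_mx (@complex.Re R) (skew_part Z)) +
    'i%C *: map_mx (real_complex R) (map_mx (@complex.Re R) (iskew_part Z)) =
    2^-1 *: (Z - Z^T).
  by apply/matrixP => i j; rewrite !mxE; exact: ReE.
have ImP : map_mx (real_complex R) (map_mx (@complex.Im R) (skew_part Z)) +
    'i%C *: map_mx (real_complex R) (map_mx (@complex.Im R) (iskew_part Z)) =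
    (2 * 'i%C)^-1 *: (Z + Z^T).
  by apply/matrixP => i j; rewrite !mxE; exact: ImE.
rewrite /tangent_act; move: (skew_part Z) (iskew_part Z) ReP ImP => S S' ReP ImP.
by rewrite !map_unitary_block; exact: add_scale_block ReP ImP.
Qed.

Fact tangent_act_is_linear : linear tangent_act.
Proof.
move=> a X Y; rewrite !tangent_actE scale_block_mx add_block_mx.
by congr block_mx; apply/matrixP => i j; rewrite !mxE; ring.
Qed.

HB.instance Definition _ := GRing.isLinear.Build R[i] 'M[R[i]]_n
  'M[R[i]]_(n + n) *:%R tangent_act tangent_act_is_linear.

Fact tangent_act_bracket X Y :
  tangent_act (lie_bracket X Y) = lie_bracket (tangent_act X) (tangent_act Y).
Proof.
have half (x : R[i]) : x = 2 * (x * 2^-1).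
  by rewrite mulrCA divff ?mulr1 // pnatr_eq0.
have i2 : (2 * 'i%C)^-1 * (2 * 'i%C)^-1 = - (2^-1 * 2^-1) :> R[i].
  by rewrite -invfM mulrACA -[_ * 'i%C]expr2 sqr_i mulrN1 invrN invfM.
rewrite !tangent_actE.
exact: (block_bracket X Y (half 2^-1) (half (2 * 'i%C)^-1) i2).
Qed.

Definition tangent_rep : glrep R n := GlRep tangent_act_bracket.

Definition trace_form (X Y : 'M[R[i]]_n) : R[i] :=
  - 2^-1 * \tr (tangent_rep X *m tangent_rep Y).

Definition orthonormal_basis (X : (n * n).-tuple 'M[R[i]]_n) :=
  basis_of fullv X /\
  forall i j, trace_form (tnth X i) (tnth X j) = (i == j)%:R.

End Tangent.
Arguments tangent_rep : clear implicits.

Definition tens_vec (K : pzRingType) (p q : nat) (a : 'cV[K]_p) (v : 'cV[K]_q) :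
  'cV[K]_(p * q) := a *t v.

Section Weitzenbock.

Variables (R : realType) (n : nat) (V : glrep R n).

Local Notation T := (tangent_rep R n).
Local Notation TV := (tens_rep T V).

(* lam is meant to be the highest weight of V. *)
Definition relevant (lam e : 'rV[int]_n) :=
  is_weight T e /\ occurs TV (lam + e).

Definition conformal_weight_op (X : (n * n).-tuple 'M[R[i]]_n) :
    'M[R[i]]_(rdim TV) :=
  - \sum_a T (tnth X a) *t V (tnth X a).

(* F_(a (x) b) : V -> V for F in End (T (x) V): the operator determined by
   <w, F_(a (x) b) v> = <a (x) w, F (b (x) v)>, equivalently by
   component_expansion below. *)
Definition component (F : 'M[R[i]]_(rdim TV)) (a b : 'cV[R[i]]_(rdim T)) :
    'M[R[i]]_(rdim V) :=
  \matrix_(i, j) ((tens_vec a (delta_mx i 0))^T *m F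
                   *m tens_vec b (delta_mx j 0)) 0 0.

(* The operator with components f t_i t_j in the standard basis t. *)
Definition of_components (f : 'cV[R[i]]_(rdim T) -> 'cV[R[i]]_(rdim T) ->
    'M[R[i]]_(rdim V)) : 'M[R[i]]_(rdim TV) :=
  \sum_i \sum_j delta_mx i j *t f (delta_mx i 0) (delta_mx j 0).

Definition twist (F : 'M[R[i]]_(rdim TV)) : 'M[R[i]]_(rdim TV) :=
  of_components (fun a b => component F b a).

Let sum_tens (p q : nat) (G : 'I_(p * q) -> R[i]) :
  \sum_k G k = \sum_i \sum_j G (mxtens_index (i, j)).
Proof.
rewrite pair_big /=.
rewrite (reindex (fun ij : 'I_p * 'I_q => mxtens_index ij)) /=.
  by apply: eq_bigr => -[].
by exists (@mxtens_unindex p q) => k _; rewrite (mxtens_indexK, mxtens_unindexK).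
Qed.

Let tens_vecE p q (a : 'cV[R[i]]_p) (v : 'cV[R[i]]_q) i j k :
  tens_vec a v (mxtens_index (i, j)) k = a i 0 * v j 0.
Proof. by rewrite /tens_vec mxE mxtens_indexK !ord1. Qed.

Let sum_delta p (f : 'I_p -> R[i]) i :
  \sum_k f k * (delta_mx i 0 : 'cV_p) k 0 = f i.
Proof.
rewrite (bigD1 i) //= big1 => [|k ki]; first by rewrite mxE !eqxx mulr1 addr0.
by rewrite mxE (negPf ki) mulr0.
Qed.

Lemma componentE F a b i j :
  component F a b i j = \sum_k \sum_l
    a k 0 * F (mxtens_index (k, i)) (mxtens_index (l, j)) * b l 0.
Proof.
have leftE q : ((tens_vec a (delta_mx i 0))^T *m F) 0 q =
    \sum_k a k 0 * F (mxtens_index (k, i)) q.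
  rewrite mxE sum_tens; apply: eq_bigr => k _.
  rewrite -(sum_delta (fun r => a k 0 * F (mxtens_index (k, r)) q)).
  by apply: eq_bigr => r _; rewrite mxE tens_vecE mulrAC.
rewrite mxE mxE sum_tens /=.
rewrite [RHS]exchange_big /=; apply: eq_bigr => l _.
rewrite -mulr_suml -leftE.
rewrite -(sum_delta (fun r => _ 0 (mxtens_index (l, r)) * b l 0)).
by apply: eq_bigr => r _; rewrite tens_vecE mulrA.
Qed.

Lemma component_expansion F (b : 'cV_(rdim T)) (v : 'cV_(rdim V)) :
  F *m tens_vec b v =
  \sum_i tens_vec (delta_mx i 0) (component F (delta_mx i 0) b *m v).
Proof.
apply/matrixP => x y; rewrite summxE !ord1.
rewrite -[x]mxtens_unindexK; case: (mxtens_unindex x) => k r {x y}.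
under eq_bigr => i _ do rewrite tens_vecE mxE eqxx andbT.
rewrite (bigD1 k) //= big1 ?addr0 => [|i ik]; last first.
  by rewrite eq_sym (negPf ik) mul0r.
rewrite eqxx mul1r mxE sum_tens mxE exchange_big /=.
apply: eq_bigr => j _; rewrite componentE exchange_big /= mulr_suml.
apply: eq_bigr => l _.
under [in RHS]eq_bigr => i _ do rewrite -mulrA mulrC.
by rewrite sum_delta tens_vecE mulrA.
Qed.

Lemma component_twist F a b : component (twist F) a b = component F b a.
Proof.
apply/matrixP => i j; rewrite !componentE exchange_big /=.
apply: eq_bigr => k _; apply: eq_bigr => l _.
suff -> : twist F (mxtens_index (l, i)) (mxtens_index (k, j)) =
          F (mxtens_index (k, i)) (mxtens_index (l, j)) by ring.
rewrite /twist /of_components summxE (bigD1 l) //= summxE (bigD1 k) //=.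
rewrite !big1 ?addr0; first last.
- by move=> q qk; rewrite mxE !mxtens_indexK mxE /= [k == q]eq_sym (negPf qk) andbF
    mul0r.
- move=> p pl; rewrite summxE big1 // => q _.
  by rewrite mxE !mxtens_indexK mxE /= [l == p]eq_sym (negPf pl) mul0r.
rewrite mxE !mxtens_indexK mxE !eqxx mul1r componentE exchange_big /=.
rewrite -[RHS](sum_delta (fun q => F (mxtens_index (k, i)) (mxtens_index (q, j)))).
apply: eq_bigr => q _; rewrite -mulr_suml; congr (_ * _).
rewrite -[RHS](sum_delta (fun p => F (mxtens_index (p, i)) (mxtens_index (q, j)))).
by apply: eq_bigr => p _; rewrite mulrC.
Qed.

End Weitzenbock.

(* Main.v *)
From HB Require Import structures.
Require Import Defs.
From mathcomp Require Import all_boot all_order all_algebra.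
From mathcomp Require Import ring zify.
Import GRing.Theory.
Local Open Scope ring_scope.

Set Implicit Arguments.
Unset Strict Implicit.
Unset Printing Implicit Defensive.
Import Order.TTheory Num.Theory.

(** The tangent representation splits as the sum of the standard representation
    on n-space and its dual, with a Boolean [s] selecting the summand
    ([true]: weights +eps, [false]: weights -eps).  The summands are isotropic
    for the scalar product, so they are dual to each other, and the twist is the
    transposition of the first tensor factor ([twistE]).  The conformal weight
    operator is B = sum_ij T(E_ij) (x) V(E_ji) ([conformal_weight_opE]).

    The theorem rests on one identity, [ptranspose_casimir].  Let F be equivariant,
    supported on the summand [s], with B F = b F.  In twist F . B, the factor
    V(E_ji) stands to the right of F; moving it to the left by equivariance of F
    produces B F, the Casimir operator of T (the scalar n), and the contraction
    sum_ij T(E_ij) F T(E_ji), which is the partial trace of F on the summand.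
    Hence
      twist F . B = p (x) tr_T F - (b + n) twist F,
    p being the projection onto the other summand.  For F the projection onto
    V_(lam + e), the partial trace is an equivariant endomorphism of V_lam, hence
    a scalar, and taking traces gives dim V_(lam + e) / dim V_lam ([ptrace_pr]).
    Multiplying on the right by the projection for e', on which B is the scalar
    b_e', yields (b_e + b_e' + n) twist F . pr_e' = (that ratio) pr_e'.  Neither
    the ratio nor pr_e' vanishes, so b_e + b_e' + n is nonzero, and the matrix
    coefficient is read off.

    It remains to know that the projections with e in a given summand are
    orthogonal idempotents whose sum is the projection onto that summand
    ([pr_orth], [sum_pr]).  Complete reducibility is not invoked.  If the sum were
    smaller, its complement would contain a submodule of least positive dimension,
    which is irreducible and has a vector w annihilated by the raising operators.
    The component of w along the lowest tangent vector that occurs in it is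
    annihilated by the raising operators of V_lam, so it is a highest weight vector
    there; thus w has weight lam + e for a weight e of T, and is determined by it up
    to a factor ([tensor_singular_weight], [tensor_singular_unique]).  So e is
    relevant, pr_e fixes w, and w is not in the complement.

    The general theory of gl_n-modules needed for this is developed without the
    Poincare-Birkhoff-Witt theorem: uniqueness of the highest weight vector of an
    irreducible module ([irreducible_singular_unique]), dominance of highest weights
    ([singular_dominant]) and uniqueness of the dimension of the irreducible module
    of a given highest weight ([dim_hw_submodule]). *)

(** * Linear predicates and joint eigenvectors *)

Section LinearPredicates.

Variables (K : fieldType) (E : vectType K).
Implicit Type Q : E -> Prop.

(** Submodules are handled as predicates, since most of them arise as
    conditions on vectors; [linear_pred_vspace] turns them into subspaces. *)
Definition linear_pred Q := Q 0 /\ forall a x y, Q x -> Q y -> Q (a *: x + y).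

Section Closure.
Variables (Q : E -> Prop) (linQ : linear_pred Q).

Lemma linear_predD x y : Q x -> Q y -> Q (x + y).
Proof. by move=> qx qy; rewrite -[x]scale1r; apply: linQ.2. Qed.

Lemma linear_predZ a x : Q x -> Q (a *: x).
Proof. by move=> qx; rewrite -[_ *: _]addr0; apply: linQ.2 => //; apply: linQ.1. Qed.

Lemma linear_predN x : Q x -> Q (- x).
Proof. by rewrite -scaleN1r; apply: linear_predZ. Qed.

Lemma linear_predB x y : Q x -> Q y -> Q (x - y).
Proof. by move=> qx /linear_predN; apply: linear_predD. Qed.

Lemma linear_pred_sum (I : finType) (F : I -> E) :
  (forall i, Q (F i)) -> Q (\sum_i F i).
Proof.
move=> qF; apply: big_ind => //; first exact: linQ.1.
by move=> x y; apply: linear_predD.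
Qed.

End Closure.

Lemma linear_pred_mem (U : {vspace E}) : linear_pred (fun x => x \in U).
Proof. by split=> [|a x y ? ?]; rewrite ?mem0v // memvD ?memvZ. Qed.

Lemma linear_pred_and Q Q' : linear_pred Q -> linear_pred Q' ->
  linear_pred (fun x => Q x /\ Q' x).
Proof.
move=> [q0 qD] [q0' qD']; split=> // a x y [qx qx'] [qy qy'].
by split; [apply: qD | apply: qD'].
Qed.

(** A subspace of greatest dimension among those on which [Q] holds must contain
    every vector satisfying [Q], or a line could be added to it. *)
Lemma linear_pred_vspace Q : linear_pred Q ->
  exists U : {vspace E}, forall x, x \in U <-> Q x.
Proof.
move=> linQ.
pose inQ (U : {vspace E}) := forall x, x \in U -> Q x.
pose P m := `[< exists2 U : {vspace E}, inQ U & \dim U = m >].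
have exP : exists m, P m.
  exists 0%N; apply/asboolP; exists 0%VS; last by rewrite dimv0.
  by move=> x; rewrite memv0 => /eqP ->; apply: linQ.1.
have ubP m : P m -> (m <= \dim {: E})%N.
  by move=> /asboolP[U _ <-]; apply/dimvS/subvf.
case: (ex_maxnP exP ubP) => m /asboolP[U UQ dimU] maxm.
exists U => x; split=> [|qx]; first exact: UQ.
have: (\dim (U + <[x]>) <= \dim U)%N.
  rewrite dimU; apply: maxm; apply/asboolP; exists (U + <[x]>)%VS => //.
  move=> y /memv_addP[u /UQ qu [v /vlineP[a ->] ->]].
  by rewrite addrC; apply: linQ.2.
move=> le; have/eqP -> : U == (U + <[x]>)%VS.
  by rewrite eqEdim addvSl le.
by apply: (subvP (addvSr _ _)); apply: memv_line.
Qed.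

End LinearPredicates.

Definition stable_pred (K : fieldType) d (Q : 'cV[K]_d -> Prop) (A : 'M_d) :=
  forall x, Q x -> Q (A *m x).

Section Operators.

Variables (R : rcfType) (d : nat).
Local Notation C := R[i].
Implicit Types (A : 'M[C]_d) (x v : 'cV[C]_d).

(** Finiteness of the spectrum bounds the length of weight strings. *)
Lemma eigenvalues_in_roots A :
  exists rs : seq C, forall c v, v != 0 -> A *m v = c *: v -> c \in rs.
Proof.
have [rs rsE] := closed_field_poly_normal (char_poly A^T).
exists rs => c v v0 Av.
have : eigenvalue A^T c.
  apply/eigenvalueP; exists v^T; first by rewrite -trmx_mul Av linearZ.
  by rewrite -trmx0 (inj_eq trmx_inj).
rewrite eigenvalue_root_char rsE rootZ ?root_prod_XsubC //.
by rewrite lead_coef_eq0 -size_poly_eq0 size_char_poly.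
Qed.

End Operators.

Section CommonEigenvector.

Variables (R : rcfType) (d : nat).
Local Notation C := R[i].
Implicit Types (A : 'M[C]_d) (Q : 'cV[C]_d -> Prop).

(** Apply to [x] the linear factors of the characteristic polynomial one after the
    other: the last nonzero vector obtained is an eigenvector satisfying [Q]. *)
Lemma eigenvector_in_pred Q A : linear_pred Q -> stable_pred Q A ->
  forall x, x != 0 -> Q x ->
  exists c (v : 'cV[C]_d), [/\ v != 0, Q v & A *m v = c *: v].
Proof.
move=> linQ QA x x0 Qx.
case: d A Q x x0 Qx linQ QA => [|d'] A Q x x0 Qx linQ QA.
  by case/negP: x0; apply/eqP/matrixP => -[].
have [rs rsE] := closed_field_poly_normal (char_poly A).
have : horner_mx A (\prod_(z <- rs) ('X - z%:P)) *m x = 0.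
  have := Cayley_Hamilton A; rewrite rsE.
  rewrite (monicP (char_poly_monic A)) scale1r => ->.
  by rewrite mul0mx.
elim: rs x x0 Qx {rsE} => [|r rs IH] x x0 Qx.
  by rewrite big_nil rmorph1 mul1mx => x0'; rewrite x0' eqxx in x0.
rewrite big_cons mulrC rmorphM /= -mulmxA => kill.
have [Ax|Ax] := eqVneq (horner_mx A ('X - r%:P) *m x) 0.
  exists r, x; split=> //; apply/eqP; rewrite -subr_eq0 -[X in _ == X]Ax.
  by rewrite rmorphB /= horner_mx_X horner_mx_C mulmxBl mul_scalar_mx.
apply: IH Ax _ kill.
rewrite rmorphB /= horner_mx_X horner_mx_C mulmxBl mul_scalar_mx.
by apply: linear_predB => //; [apply: QA | apply: linear_predZ].
Qed.

Lemma common_eigenvector_in_pred (I : eqType) (s : seq I) (A : I -> 'M[C]_d) Q :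
    (forall i j, A i *m A j = A j *m A i) ->
    linear_pred Q -> (forall i, stable_pred Q (A i)) ->
    forall x, x != 0 -> Q x ->
  exists2 v : 'cV[C]_d, v != 0 /\ Q v &
    forall i, i \in s -> exists c, A i *m v = c *: v.
Proof.
move=> comm; elim: s Q => [|i s IH] Q linQ QA x x0 Qx; first by exists x.
have [c [v [v0 Qv Av]]] := eigenvector_in_pred linQ (QA i) x0 Qx.
have linQ' : linear_pred (fun y => Q y /\ A i *m y = c *: y).
  apply: linear_pred_and => //; split=> [|a y z Ay Az].
    by rewrite mulmx0 scaler0.
  by rewrite mulmxDr -scalemxAr Ay Az scalerDr !scalerA mulrC.
have QA' j : stable_pred (fun y => Q y /\ A i *m y = c *: y) (A j).
  move=> y [Qy Ay]; split; first exact: QA.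
  by rewrite mulmxA comm -mulmxA Ay scalemxAr.
have [w [w0 [Qw Aw]] eigw] := IH _ linQ' QA' v v0 (conj Qv Av).
exists w => // j; rewrite inE => /predU1P[-> | /eigw //]; by exists c.
Qed.

End CommonEigenvector.

(** * Highest weight theory of gl_n-modules *)

Section Representation.

Variables (R : realType) (n : nat) (W : glrep R n).
Local Notation C := R[i].
Local Notation vec := 'cV[C]_(rdim W).
Implicit Types (Q : vec -> Prop) (x y w : vec) (chi : 'I_n -> C).

Lemma ract_swap X Y x :
  W X *m (W Y *m x) = W Y *m (W X *m x) + W (lie_bracket X Y) *m x.
Proof. by rewrite ract_bracket /lie_bracket mulmxBl !mulmxA addrC subrK. Qed.

Lemma ract_sum_delta Z x :
  W Z *m x = \sum_i \sum_j Z i j *: (W (delta_mx i j) *m x).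
Proof.
rewrite {1}[Z]matrix_sum_delta linear_sum mulmx_suml; apply: eq_bigr => i _.
rewrite linear_sum mulmx_suml; apply: eq_bigr => j _.
by rewrite linearZ scalemxAl.
Qed.

Definition submodule_pred Q := linear_pred Q /\ forall Z, stable_pred Q (W Z).

Lemma submodule_pred_and Q Q' :
  submodule_pred Q -> submodule_pred Q' -> submodule_pred (fun x => Q x /\ Q' x).
Proof.
move=> [linQ QZ] [linQ' QZ']; split; first exact: linear_pred_and.
by move=> Z x [qx qx']; split; [apply: QZ | apply: QZ'].
Qed.

Lemma submodule_pred_mem (U : {vspace vec}) :
  submodule U -> submodule_pred (fun x => x \in U).
Proof. by move=> subU; split; [apply: linear_pred_mem | move=> Z x; apply: subU]. Qed.

Lemma submodule_pred_fix A a :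
  equivariant A -> submodule_pred (fun x => A *m x = a *: x).
Proof.
move=> eqA; split; first split=> [|b x y Ax Ay].
- by rewrite mulmx0 scaler0.
- by rewrite mulmxDr -scalemxAr Ax Ay scalerDr !scalerA mulrC.
- by move=> Z x Ax; rewrite mulmxA eqA -mulmxA Ax scalemxAr.
Qed.

Lemma irreducible_pred (U : {vspace vec}) Q x :
    irreducible_submodule U -> submodule_pred Q -> x \in U -> x != 0 -> Q x ->
  forall y, y \in U -> Q y.
Proof.
move=> [subU U0 irrU] subQ xU x0 Qx y yU.
have [lin st2] := submodule_pred_and (submodule_pred_mem subU) subQ.
have [U' U'E] := linear_pred_vspace lin.
have subU' : submodule U' by move=> Z z /U'E z'; apply/U'E/st2.
have leU' : (U' <= U)%VS by apply/subvP => z /U'E[].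
have [U'0 | U'U] := irrU _ subU' leU'.
  have : x \in U' by apply/U'E.
  by rewrite U'0 memv0 (negPf x0).
by have /U'E[] : y \in U' by rewrite U'U.
Qed.

(** A nonzero submodule of least dimension is irreducible. *)
Lemma irreducible_in_pred Q x :
    submodule_pred Q -> x != 0 -> Q x ->
  exists2 U : {vspace vec}, irreducible_submodule U & forall y, y \in U -> Q y.
Proof.
move=> [lin st] x0 Qx.
pose inQ (U : {vspace vec}) :=
  [/\ submodule U, U != 0%VS & forall y, y \in U -> Q y].
pose P m := `[< exists2 U, inQ U & \dim U = m >].
have exP : exists m, P m.
  have [U UE] := linear_pred_vspace lin.
  exists (\dim U); apply/asboolP; exists U => //; split.
  - by move=> Z y /UE Qy; apply/UE/st.
  - by apply: contraNneq x0 => U0; rewrite -memv0 -U0; apply/UE.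
  - by move=> y /UE.
case: (ex_minnP exP) => m /asboolP[U [subU U0 UQ] dimU] minm.
exists U => //; split=> // U' subU' leU'.
have [->|U'0] := eqVneq U' 0%VS; [by left | right].
apply/eqP; rewrite eqEdim leU' dimU minm //.
apply/asboolP; exists U' => //; split=> // y yU'.
exact/UQ/(subvP leU').
Qed.

(** The weight is allowed to be complex and [w] to be zero: vectors found as joint
    eigenvectors have no integrality built in, and linear combinations stay singular. *)
Definition singular chi w :=
  (forall k, W (delta_mx k k) *m w = chi k *: w) /\
  forall i j : 'I_n, (i < j)%N -> W (delta_mx i j) *m w = 0.

Lemma highest_weight_vectorP kappa w :
  highest_weight_vector (V := W) kappa w <->
  w != 0 /\ singular (fun k => (kappa 0 k)%:~R) w.
Proof. by split=> [[[]] | [? []]]. Qed.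

Lemma linear_pred_singular chi : linear_pred (singular chi).
Proof.
split; first by split=> *; rewrite mulmx0 ?scaler0.
move=> a x y [xk xij] [yk yij]; split=> [k | i j ij].
  by rewrite mulmxDr -scalemxAr xk yk scalerDr !scalerA mulrC.
by rewrite mulmxDr -scalemxAr xij ?yij // scaler0 addr0.
Qed.

(** A single torus element suffices to order the weights: every E_ij with i > j
    lowers its eigenvalue by the positive integer i - j ([height_op_delta]). *)
Definition height_op : 'M[C]_n := diag_mx (\row_(k < n) - k%:R).

Definition height chi : C := \sum_(k < n) - k%:R * chi k.

Lemma torus_height chi w : (forall k, W (delta_mx k k) *m w = chi k *: w) ->
  W height_op *m w = height chi *: w.
Proof.
move=> wk; rewrite ract_sum_delta scaler_suml; apply: eq_bigr => i _.
rewrite (bigD1 i) //= big1 ?addr0 => [|j ji]; last first.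
  by rewrite !mxE eq_sym (negPf ji) scale0r.
by rewrite !mxE eqxx mulr1n wk scalerA.
Qed.

Lemma singular_height chi w : singular chi w -> W height_op *m w = height chi *: w.
Proof. by move=> [/torus_height]. Qed.

Lemma height_op_delta x (i j : 'I_n) :
  W height_op *m (W (delta_mx i j) *m x) =
  W (delta_mx i j) *m (W height_op *m x) + (j%:R - i%:R) *: (W (delta_mx i j) *m x).
Proof.
rewrite ract_swap; congr (_ + _); rewrite scalemxAl -linearZ; congr (W _ *m x).
apply/matrixP => k l; rewrite /lie_bracket mul_diag_mx mul_mx_diag !mxE.
have [->|] := eqVneq k i; last by rewrite /= !(mulr0, mul0r) subrr.
have [->|] := eqVneq l j; last by rewrite /= !(mulr0, mul0r) subrr.
by rewrite /= mulr1; ring.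
Qed.

(** [x] is annihilated by the product of [height_op - (h - m)] for m < D, that is, [x]
    lies in the sum of the height eigenspaces h, h - 1, ..., h - D + 1. *)
Fixpoint height_below D (h : C) x : Prop :=
  if D is D'.+1 then height_below D' (h - 1) (W height_op *m x - h *: x)
  else x = 0.

Lemma linear_height_below D h : linear_pred (height_below D h).
Proof.
elim: D h => [|D IH] h /=; first by split=> // a x y -> ->; rewrite scaler0 addr0.
split=> [|a x y qx qy]; first by rewrite mulmx0 scaler0 subrr; apply: (IH _).1.
have -> : W height_op *m (a *: x + y) - h *: (a *: x + y) =
    a *: (W height_op *m x - h *: x) + (W height_op *m y - h *: y).
  rewrite mulmxDr -scalemxAr scalerDr opprD scalerBr !scalerA [h * a]mulrC.
  by rewrite addrACA.
exact: (IH _).2.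
Qed.

Lemma height_below_op D h x :
  height_below D h x -> height_below D h (W height_op *m x).
Proof.
elim: D h x => [|D IH] h x /=; first by move->; rewrite mulmx0.
by move=> /IH; rewrite mulmxBr -scalemxAr.
Qed.

Lemma height_below_raise D h x : height_below D h x -> height_below D.+1 (h + 1) x.
Proof.
move=> qx /=; rewrite addrK; apply: (linear_predB (linear_height_below _ _)).
  exact: height_below_op.
exact: (linear_predZ (linear_height_below _ _)).
Qed.

Lemma height_below_leq D D' h x :
  (D <= D')%N -> height_below D h x -> height_below D' h x.
Proof.
elim: D D' h x => [|D IH] [|D'] h x //= le.
  by move=> ->; apply: (linear_height_below D'.+1 _).1.
exact: IH.
Qed.

Lemma height_below_shift D h x m :
  height_below D (h - m%:R) x -> height_below (D + m) h x.
Proof.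
elim: m h => [|m IH] h; first by rewrite subr0 addn0.
move=> hb; rewrite addnS -[h](subrK 1); apply/height_below_raise/IH.
by rewrite -addrA -opprD nat1r.
Qed.

Lemma height_below_lower D h x (i j : 'I_n) : (j < i)%N ->
  height_below D h x -> height_below (D + (i - j)) h (W (delta_mx i j) *m x).
Proof.
move=> ji hx; apply: height_below_shift.
elim: D h x hx => [|D IH] h x /=; first by move->; rewrite mulmx0.
move=> /IH; rewrite height_op_delta mulmxBr -scalemxAr.
have -> : h - 1 - (i - j)%:R = h - (i - j)%:R - 1 by ring.
congr (height_below _ _ _); rewrite -addrA -scalerBl -scaleNr.
by congr (_ + _ *: _); rewrite natrB 1?ltnW //; ring.
Qed.

Lemma height_below_eigen D h c x :
    W height_op *m x = c *: x -> height_below D h x -> x != 0 ->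
  exists2 m, (m < D)%N & c = h - m%:R.
Proof.
elim: D h x => [|D IH] h x Hx /=; first by move=> -> /eqP.
rewrite Hx -scalerBl => hb x0.
have [/eqP|ch] := eqVneq (c - h) 0.
  by rewrite subr_eq0 => /eqP ->; exists 0%N; rewrite ?subr0.
have [||m mD ->] := IH _ _ _ hb.
- by rewrite -scalemxAr Hx !scalerA mulrC.
- by rewrite scaler_eq0 negb_or ch.
- by exists m.+1; rewrite // -addrA -opprD nat1r.
Qed.

(** Height eigenspaces are independent. *)
Lemma height_belowP D h x m :
  W height_op *m x = (h + m%:R) *: x -> (0 < m)%N -> height_below D h x -> x = 0.
Proof.
move=> Hx m0 hb; apply/eqP; apply: contraT => x0.
have [k _ E] := height_below_eigen Hx hb x0.
have : (m + k)%:R = 0 :> C.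
  by rewrite natrD -[m%:R](addKr h) E; ring.
by move/eqP; rewrite pnatr_eq0; case: (m) m0.
Qed.

(** For a singular [w] this is the submodule generated by [w]; the definition uses
    lowering operators only, which makes the height estimate of [descendant_below]
    immediate. *)
Inductive descendant w : vec -> Prop :=
| Descendant_self : descendant w w
| Descendant_lin a x y : descendant w x -> descendant w y -> descendant w (a *: x + y)
| Descendant_lower (i j : 'I_n) x : (j < i)%N -> descendant w x ->
    descendant w (W (delta_mx i j) *m x).

Lemma linear_descendant w : linear_pred (descendant w).
Proof.
split; last exact: Descendant_lin.
rewrite -(addNr w) -scaleN1r.
by apply: Descendant_lin; apply: Descendant_self.
Qed.

(** The span of the iterated lowerings of a singular vector is stable under all of
    gl_n: in Z f x = f Z x + [Z, f] x both Z x and [Z, f] x are descendants by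
    induction on the number of lowerings. *)
Lemma submodule_descendant chi w : singular chi w -> submodule_pred (descendant w).
Proof.
move=> [wk wij]; split=> [|Z x dx]; first exact: linear_descendant.
elim: dx Z => {x} [|a x y _ IHx _ IHy|i j x ji dx IH] Z.
- have lin := linear_descendant w.
  rewrite ract_sum_delta; apply: linear_pred_sum => // i.
  apply: linear_pred_sum => // j; apply: linear_predZ => //.
  have [ij|ji|/val_inj <-] := ltngtP i j.
  + by rewrite wij //; apply: lin.1.
  + by apply: Descendant_lower => //; apply: Descendant_self.
  + by rewrite wk; apply: linear_predZ => //; apply: Descendant_self.
- by rewrite mulmxDr -scalemxAr; apply: Descendant_lin.
- rewrite ract_swap; apply: (linear_predD (linear_descendant w)) => //.
  exact: Descendant_lower.
Qed.

(** Modulo multiples of [w], everything generated by [w] has smaller height. *)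
Lemma descendant_below chi w x : singular chi w -> descendant w x ->
  exists a D, height_below D (height chi - 1) (x - a *: w).
Proof.
move=> sw; elim=> {x} [|b x y _ [a [D Dx]] _ [a' [D' Dy]]|i j x ji _ [a [D Dx]]].
- by exists 1, 0%N; rewrite scale1r subrr.
- exists (b * a + a'), (maxn D D').
  have -> : b *: x + y - (b * a + a') *: w = b *: (x - a *: w) + (y - a' *: w).
    by rewrite scalerBr scalerDl scalerA opprD addrACA.
  apply: (linear_height_below _ _).2.
    by apply: height_below_leq Dx; rewrite leq_maxl.
  by apply: height_below_leq Dy; rewrite leq_maxr.
(* the lowering of [w] itself already has smaller height, so the coefficient is 0 *)
- exists 0, (maxn (D + (i - j)) (1 + (i - j).-1)); rewrite scale0r subr0.
  have -> : W (delta_mx i j) *m x =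
      a *: (W (delta_mx i j) *m w) + W (delta_mx i j) *m (x - a *: w).
    by rewrite mulmxBr -scalemxAr addrC subrK.
  apply: (linear_height_below _ _).2; last first.
    apply: height_below_leq (height_below_lower ji Dx).
    by rewrite leq_maxl.
  have hw : height_below 1 (height chi - (i - j)%:R) (W (delta_mx i j) *m w).
    rewrite /= height_op_delta (singular_height sw) -scalemxAr -scalerDl -scalerBl.
    rewrite natrB 1?ltnW // -[RHS](scale0r (W (delta_mx i j) *m w)).
    by congr (_ *: _); ring.
  apply: height_below_leq (leq_maxr _ _) _; apply: height_below_shift.
  by rewrite -addrA -opprD nat1r prednK // subn_gt0.
Qed.

(** Each of two singular vectors of an irreducible module is a descendant of the
    other, so neither has the smaller height; having the height of [w], the
    vector [w'] is a multiple of [w] by [descendant_below]. *)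
Lemma irreducible_singular_unique (U : {vspace vec}) chi chi' w w' :
    irreducible_submodule U -> w \in U -> w' \in U -> w != 0 ->
    singular chi w -> singular chi' w' ->
  exists a, w' = a *: w.
Proof.
move=> irrU wU w'U w0 sw sw'.
have [->|w'0] := eqVneq w' 0; first by exists 0; rewrite scale0r.
have gen := irreducible_pred irrU.
have dw' : descendant w w'.
  exact: gen (submodule_descendant sw) wU w0 (Descendant_self w) _ w'U.
have dw : descendant w' w.
  exact: gen (submodule_descendant sw') w'U w'0 (Descendant_self w') _ wU.
have heights u u' psi psi' : singular psi u -> singular psi' u' ->
    descendant u u' -> u' != 0 -> exists m, height psi' = height psi - m%:R.
  move=> su su' duu' u'0; have [a [D Du]] := descendant_below su duu'.
  have : height_below D.+1 (height psi) u'.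
    rewrite -[u'](subrK (a *: u)); apply: (linear_predD (linear_height_below _ _)).
      by rewrite -[height psi](subrK 1); apply: height_below_raise.
    apply: (linear_predZ (linear_height_below _ _)) => /=.
    rewrite (singular_height su) subrr.
    exact: (linear_height_below _ _).1.
  by move=> /(height_below_eigen (singular_height su'))/(_ u'0)[m _ ->]; exists m.
have [m hm] := heights _ _ _ _ sw sw' dw' w'0.
have [m' hm'] := heights _ _ _ _ sw' sw dw w0.
have hh : height chi' = height chi.
  have e : m%:R = height chi - height chi' by rewrite hm; ring.
  have e' : m'%:R = height chi' - height chi by rewrite hm'; ring.
  have /eqP : (m + m')%:R = 0 :> C by rewrite natrD e e'; ring.
  by rewrite hm pnatr_eq0; case: (m) => // _; rewrite subr0.
have [a [D Da]] := descendant_below sw dw'; exists a.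
apply/eqP; rewrite -subr_eq0; apply/eqP.
apply: (@height_belowP D _ _ 1) Da => //.
rewrite subrK mulmxBr -scalemxAr (singular_height sw) (singular_height sw') hh.
by rewrite scalerBr !scalerA mulrC.
Qed.

Lemma torus_delta x (k i j : 'I_n) :
  W (delta_mx k k) *m (W (delta_mx i j) *m x) =
  W (delta_mx i j) *m (W (delta_mx k k) *m x) +
  ((k == i)%:R - (k == j)%:R) *: (W (delta_mx i j) *m x).
Proof.
rewrite ract_swap; congr (_ + _); rewrite scalemxAl -linearZ; congr (W _ *m x).
rewrite /lie_bracket !mul_delta_mx_cond [j == k]eq_sym.
case: (eqVneq k i) => [<-|_]; case: (eqVneq k j) => [<-|_];
  by rewrite ?mulr1n ?mulr0n scalerBl ?scale1r ?scale0r.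
Qed.

(** Start from a joint eigenvector of the torus and raise it until all raising
    operators annihilate it.  Each step increases the height by a positive integer,
    and there are finitely many eigenvalues. *)
Lemma exists_singular Q x : submodule_pred Q -> x != 0 -> Q x ->
  exists chi w, [/\ w != 0, Q w & singular chi w].
Proof.
move=> [lin st] x0 Qx.
pose D k := W (delta_mx k k).
have DD k l : D k *m D l = D l *m D k.
  apply/eqP; rewrite -subr_eq0; apply/eqP.
  rewrite -[LHS]/(lie_bracket _ _) -ract_bracket /lie_bracket.
  rewrite !mul_delta_mx_cond eq_sym; case: eqP => [->|_]; rewrite subrr ?linear0 //.
have [v [v0 Qv] eigv] :=
  common_eigenvector_in_pred (enum 'I_n) DD lin (fun k => st _) x0 Qx.
have /boolp.choice[chi vchi] : forall k, exists c, D k *m v = c *: v.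
  by move=> k; apply: eigv; rewrite mem_enum.
have [rs rsP] := eigenvalues_in_roots (W height_op).
(* the number of eigenvalues that are still higher: it decreases at each raising step *)
pose above (c : C) := count (fun r => complex.Re c < complex.Re r) rs.
have [N] := ubnP (above (height chi)).
elim: N chi v v0 Qv vchi {eigv} => // N IH chi v v0 Qv vchi ltN.
have [/existsP[i /existsP[j /andP[ij vij]]]|none] :=
    boolP [exists i : 'I_n, exists j : 'I_n, (i < j)%N && (W (delta_mx i j) *m v != 0)];
  last first.
  exists chi, v; split=> //; split=> // i j ij.
  by apply/eqP; apply: contraNT none => vij; apply/existsP; exists i; apply/existsP;
    exists j; rewrite ij.
pose chi' k := chi k + ((k == i)%:R - (k == j)%:R).
have v'chi k : D k *m (W (delta_mx i j) *m v) = chi' k *: (W (delta_mx i j) *m v).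
  by rewrite torus_delta vchi -scalemxAr -scalerDl.
apply: (IH _ _ vij (st _ _ Qv) v'chi); rewrite ltnS in ltN; apply: leq_trans ltN.
set v' := _ *m v in vij v'chi.
have hE : height chi' = height chi + (j%:R - i%:R).
  have /eqP : height chi' *: v' = (height chi + (j%:R - i%:R)) *: v'.
    rewrite -(torus_height v'chi) height_op_delta (torus_height vchi).
    by rewrite -scalemxAr -scalerDl.
  by rewrite -subr_eq0 -scalerBl scaler_eq0 (negPf vij) orbF subr_eq0 => /eqP.
have inrs : height chi' \in rs by apply: rsP vij _; apply: torus_height.
have lt : complex.Re (height chi) < complex.Re (height chi').
  rewrite hE -natrB 1?ltnW // raddfD /= -(rmorph_nat (real_complex R)) /=.
  by rewrite ltrDl ltr0n subn_gt0.
(* the new eigenvalue is among those counted before, not among those counted now *)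
pose a := [pred r | complex.Re (height chi') < complex.Re r].
pose u := pred1 (height chi').
have aIu : count (predI a u) rs = 0%N.
  rewrite -(count_pred0 rs); apply: eq_count => r /=.
  by apply/negP => /andP[ltr /eqP rE]; rewrite rE ltxx in ltr.
have u0 : (0 < count u rs)%N by rewrite -has_count has_pred1.
have := count_predUI a u rs; rewrite aIu addn0 => aUu.
apply: (@leq_trans (count (predU a u) rs)); first by rewrite aUu -addn1 leq_add2l.
apply: sub_count => r /= /orP[|/eqP -> //]; exact: lt_trans.
Qed.

(** Otherwise, with i < j and m = kappa_i - kappa_j < 0, the sl_2 relation
    E_ij E_ji^(k+1) w = (k + 1) (m - k) E_ji^k w shows that no E_ji^k w vanishes, and
    these vectors have infinitely many distinct E_ii-eigenvalues. *)
Lemma singular_dominant (kappa : 'rV[int]_n) w :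
  w != 0 -> singular (fun k => (kappa 0 k)%:~R) w -> dominant kappa.
Proof.
move=> w0 [wk wij] i j; rewrite leq_eqVlt => /predU1P[/val_inj -> // | ij].
rewrite leNgt; apply/negP => kij.
pose f k := iter k (mulmx (W (delta_mx j i))) w.
pose m : C := (kappa 0 i)%:~R - (kappa 0 j)%:~R.
have tf k l : W (delta_mx l l) *m f k =
    ((kappa 0 l)%:~R + k%:R * ((l == j)%:R - (l == i)%:R)) *: f k.
  elim: k => [|k IH]; first by rewrite mul0r addr0 wk.
  rewrite /= torus_delta IH -scalemxAr -scalerDl; congr (_ *: _).
  by rewrite -[k.+1%:R]natr1; ring.
have step k : W (delta_mx i j) *m f k.+1 =
    W (delta_mx j i) *m (W (delta_mx i j) *m f k) + (m - 2 * k%:R) *: f k.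
  rewrite {1}/f iterS -/(f k) ract_swap; congr (_ + _).
  rewrite /lie_bracket !mul_delta_mx linearB mulmxBl !tf -scalerBl !eqxx.
  have /negPf ji : j != i by apply: contraTneq ij => ->; rewrite ltnn.
  by rewrite ji eq_sym ji /m; congr (_ *: _); rewrite !(mulr1n, mulr0n); ring.
have ef k : W (delta_mx i j) *m f k.+1 = (k.+1%:R * (m - k%:R)) *: f k.
  elim: k => [|k IH].
    by rewrite step /f /= wij // mulmx0 add0r; congr (_ *: _); ring.
  rewrite step IH -scalemxAr -/(f k.+1) -scalerDl; congr (_ *: _).
  by rewrite -[k.+2%:R]natr1 -[k.+1%:R]natr1; ring.
have f0 k : f k != 0.
  elim: k => // k IH; apply: contraNneq IH => fk.
  move/eqP: (ef k); rewrite fk mulmx0 eq_sym scaler_eq0 mulf_eq0 pnatr_eq0 /=.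
  case/orP=> //; rewrite /m -rmorphB -[k%:R]/(k%:~R) -rmorphB intr_eq0 => /eqP.
  by lia.
have [rs rsP] := eigenvalues_in_roots (W (delta_mx i i)).
pose s := [seq (kappa 0 i)%:~R - k%:R : C | k <- iota 0 (size rs).+1].
have uniqs : uniq s.
  rewrite map_inj_uniq ?iota_uniq // => k l /addrI/oppr_inj/eqP.
  by rewrite eqr_nat => /eqP.
have : (size s <= size rs)%N.
  apply: uniq_leq_size => // _ /mapP[k _ ->]; apply: (rsP _ (f k)) => //.
  have /negPf ij' : i != j by apply: contraTneq ij => ->; rewrite ltnn.
  by rewrite tf eqxx ij'; congr (_ *: _); rewrite mulr1n mulr0n; ring.
by rewrite size_map size_iota ltnn.
Qed.

End Representation.

(** * Intertwiners and dimensions *)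

Lemma mulmx_cV_ext (K : fieldType) m p (A B : 'M[K]_(m, p)) :
  (forall x : 'cV_p, A *m x = B *m x) -> A = B.
Proof.
move=> AB; apply/matrixP => i j.
by have /colP/(_ i) := AB (delta_mx j 0); rewrite -!colE !mxE.
Qed.

(** Write the projection as B c with B the matrix of a basis of [U] and c the matrix of
    coordinates; then c B is the identity matrix of size dim U. *)
Lemma trace_projection (K : fieldType) d (P : 'M[K]_d) (U : {vspace 'cV[K]_d}) :
    (forall v, P *m v \in U) -> (forall u, u \in U -> P *m u = u) ->
  \tr P = (\dim U)%:R.
Proof.
move=> PU Pid; pose b := vbasis U; have bU := vbasisP U.
pose B : 'M_(d, \dim U) := \matrix_(i, k) b`_k i 0.
pose c : 'M_(\dim U, d) := \matrix_(k, j) coord b k (P *m delta_mx j 0).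
have PE : P = B *m c.
  apply/matrixP => i j.
  have := coord_vbasis (PU (delta_mx j 0)); rewrite -colE => /colP/(_ i).
  rewrite mxE => ->; rewrite summxE mxE; apply: eq_bigr => k _.
  by rewrite !mxE colE mulrC.
have cB : c *m B = 1%:M.
  apply/matrixP => k l; rewrite [RHS]mxE.
  have bl : b`_l \in U by apply: vbasis_mem; rewrite mem_nth ?size_tuple.
  rewrite eq_sym -(coord_free l k (basis_free bU)) -[b`_l in RHS]Pid //.
  rewrite [b`_l in RHS]matrix_sum_delta mulmx_sumr linear_sum mxE.
  apply: eq_bigr => j _; rewrite !mxE big_ord1 -scalemxAr linearZ /=.
  by rewrite mulrC.
by rewrite PE mxtrace_mulC cB mxtrace1.
Qed.

Section Intertwiners.

Variables (R : realType) (n : nat).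
Local Notation C := R[i].
Implicit Types (D W V : glrep R n).

Definition intertwines D W (A : 'M[C]_(rdim W, rdim D)) :=
  forall Z, A *m D Z = W Z *m A.

Lemma intertwines_singular D W (A : 'M_(rdim W, rdim D)) chi w :
  intertwines A -> singular chi w -> singular chi (A *m w).
Proof.
move=> AZ [wk wij]; split=> [k|i j ij].
  by rewrite mulmxA -AZ -mulmxA wk scalemxAr.
by rewrite mulmxA -AZ -mulmxA wij // mulmx0.
Qed.

Lemma intertwines_height_below D W (A : 'M_(rdim W, rdim D)) N h x :
  intertwines A -> height_below N h x -> height_below N h (A *m x).
Proof.
move=> AZ; elim: N h x => [|N IH] h x /=; first by move->; rewrite mulmx0.
by move=> /IH; rewrite mulmxBr -scalemxAr [W _ *m _]mulmxA -AZ -mulmxA.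
Qed.

Lemma intertwines_submodule D W (A : 'M_(rdim W, rdim D)) (Q : 'cV_(rdim D) -> Prop) :
    intertwines A -> submodule_pred Q ->
  submodule_pred (fun y => exists2 x, Q x & y = A *m x).
Proof.
move=> AZ [lin st]; split; first split.
- by exists 0; [apply: lin.1 | rewrite mulmx0].
- move=> a _ _ [x qx ->] [y qy ->]; exists (a *: x + y); first exact: lin.2.
  by rewrite mulmxDr -scalemxAr.
- by move=> Z _ [x qx ->]; exists (D Z *m x); [apply: st | rewrite !mulmxA AZ].
Qed.

Lemma intertwines_ker D W (A : 'M_(rdim W, rdim D)) :
  intertwines A -> submodule_pred (fun x : 'cV_(rdim D) => A *m x = 0).
Proof.
move=> AZ; split; first split; first by rewrite mulmx0.
  by move=> a x y Ax Ay; rewrite mulmxDr -scalemxAr Ax Ay scaler0 addr0.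
by move=> Z x Ax; rewrite mulmxA AZ -mulmxA Ax mulmx0.
Qed.

Lemma descendant_image D W (A : 'M_(rdim W, rdim D)) (U : {vspace 'cV_(rdim W)}) w :
    intertwines A -> submodule U -> A *m w \in U ->
  forall x, descendant w x -> A *m x \in U.
Proof.
move=> AZ subU wU x; elim=> {x} // [a x y _ xU _ yU | i j x _ _ xU].
  by rewrite mulmxDr -scalemxAr memvD ?memvZ.
by rewrite mulmxA AZ -mulmxA; apply: subU.
Qed.

(** Schur's lemma: the image of the highest weight vector is a multiple of it by
    uniqueness, and the eigenvectors for that factor form a submodule. *)
Lemma equivariant_scalar V kappa (A : 'M[C]_(rdim V)) :
  hw_module V kappa -> equivariant A -> exists a, A = a%:M.
Proof.
move=> [irrV [w wV /highest_weight_vectorP[w0 sw]]] eqA.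
have [a Aw] := irreducible_singular_unique irrV wV (memvf (A *m w)) w0 sw
                 (intertwines_singular eqA sw).
exists a; apply: mulmx_cV_ext => x; rewrite mul_scalar_mx.
exact: irreducible_pred irrV (submodule_pred_fix a eqA) wV w0 Aw _ (memvf x).
Qed.

(** The submodule generated by a diagonal vector projects injectively to the first factor.
    Otherwise the vectors of it annihilated by [A1] would map onto the irreducible
    target of [A2], so some x' has components 0 and [A2 w].  But
    x' = a w + (terms of smaller height): the first component forces a = 0, and the
    second one then has no part of the height of [w]. *)
Lemma diagonal_intertwiner_inj D W1 W2 (A1 : 'M_(rdim W1, rdim D))
    (A2 : 'M_(rdim W2, rdim D)) (U : {vspace 'cV_(rdim W2)}) chi w :
    intertwines A1 -> intertwines A2 ->
    (forall x : 'cV_(rdim D), A1 *m x = 0 -> A2 *m x = 0 -> x = 0) ->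
    irreducible_submodule U -> A2 *m w \in U ->
    singular chi w -> A1 *m w != 0 -> A2 *m w != 0 ->
  forall x, descendant w x -> A1 *m x = 0 -> x = 0.
Proof.
move=> A1Z A2Z inj irrU wU sw w1 w2 x dx A1x.
apply/eqP; apply: contraT => x0.
have subN := submodule_descendant sw.
have subK := submodule_pred_and subN (intertwines_ker A1Z).
have A2x0 : A2 *m x != 0 by apply: contraNneq x0 => A2x; apply/eqP/inj.
have [subU _ _] := irrU.
have [|x' [dx' A1x'] A2x'] := irreducible_pred irrU (intertwines_submodule A2Z subK)
    (descendant_image A2Z subU wU dx) A2x0 _ wU; first by exists x.
have [a [N low]] := descendant_below sw dx'.
have eig W (A : 'M_(rdim W, rdim D)) b : intertwines A ->
  W (height_op R n) *m (b *: (A *m w)) = (height chi - 1 + 1%:R) *: (b *: (A *m w)).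
  move=> AZ; rewrite subrK -scalemxAr.
  by rewrite (singular_height (intertwines_singular AZ sw)) !scalerA mulrC.
have a0 : a = 0.
  have := intertwines_height_below A1Z low.
  rewrite mulmxBr A1x' sub0r -scalemxAr -scaleNr => low1.
  have /eqP := height_belowP (eig _ _ _ A1Z) (ltnSn 0) low1.
  by rewrite scaler_eq0 (negPf w1) orbF oppr_eq0 => /eqP.
move: low; rewrite a0 scale0r subr0 => /(intertwines_height_below A2Z).
rewrite -A2x' -[A2 *m w]scale1r => /(height_belowP (eig _ _ _ A2Z) (ltnSn 0))/eqP.
by rewrite scale1r (negPf w2).
Qed.

Section DirectSum.

Variables (W1 W2 : glrep R n).

Definition dsum_act Z : 'M[C]_(rdim W1 + rdim W2) := block_mx (W1 Z) 0 0 (W2 Z).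

Fact dsum_act_is_linear : linear dsum_act.
Proof.
by move=> a X Y; rewrite /dsum_act scale_block_mx add_block_mx !linearP !scaler0 !addr0.
Qed.

HB.instance Definition _ := GRing.isLinear.Build C 'M[C]_n
  'M[C]_(rdim W1 + rdim W2) *:%R dsum_act dsum_act_is_linear.

Fact dsum_act_bracket X Y :
  dsum_act (lie_bracket X Y) = lie_bracket (dsum_act X) (dsum_act Y).
Proof.
rewrite /dsum_act /lie_bracket !mulmx_block opp_block_mx add_block_mx.
by rewrite !(mulmx0, mul0mx, addr0, add0r, oppr0) -!/(lie_bracket _ _) !ract_bracket.
Qed.

Definition dsum_rep : glrep R n := GlRep dsum_act_bracket.

End DirectSum.

(** In the direct sum, the submodule generated by the pair of highest weight vectors
    projects isomorphically onto both irreducible modules. *)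
Lemma dim_hw_submodule W V kappa (U : {vspace 'cV[C]_(rdim W)}) :
  hw_submodule kappa U -> hw_module V kappa -> \dim U = rdim V.
Proof.
move=> [irrU [w1 w1U /highest_weight_vectorP[w10 sw1]]].
move=> [irrV [w2 w2V /highest_weight_vectorP[w20 sw2]]].
pose D := dsum_rep W V.
pose A1 : 'M[C]_(rdim W, rdim D) := row_mx 1%:M 0.
pose A2 : 'M[C]_(rdim V, rdim D) := row_mx 0 1%:M.
have A1E (x : 'cV[C]_(rdim D)) : A1 *m x = usubmx x.
  by rewrite -[x]vsubmxK mul_row_col mul1mx mul0mx addr0 col_mxKu.
have A2E (x : 'cV[C]_(rdim D)) : A2 *m x = dsubmx x.
  by rewrite -[x]vsubmxK mul_row_col mul1mx mul0mx add0r col_mxKd.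
have A1Z : intertwines A1.
  by move=> Z; rewrite mul_row_block mul_mx_row !mul0mx !mulmx0 mul1mx mulmx1 !addr0.
have A2Z : intertwines A2.
  by move=> Z; rewrite mul_row_block mul_mx_row !mul0mx !mulmx0 mul1mx mulmx1 !add0r.
have inj (x : 'cV[C]_(rdim D)) : A1 *m x = 0 -> A2 *m x = 0 -> x = 0.
  by rewrite A1E A2E => ux dx; rewrite -[x]vsubmxK ux dx col_mx0.
pose w : 'cV[C]_(rdim D) := col_mx w1 w2.
have Aw1 : A1 *m w = w1 by rewrite A1E col_mxKu.
have Aw2 : A2 *m w = w2 by rewrite A2E col_mxKd.
have sw : singular (fun k => (kappa 0 k)%:~R) w.
  split=> [k | i j ij]; rewrite mul_block_col !mul0mx addr0 add0r.
    by rewrite sw1.1 sw2.1 scale_col_mx.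
  by rewrite sw1.2 // sw2.2 // col_mx0.
have [subU _ _] := irrU; have [subV _ _] := irrV.
have subN := submodule_descendant sw.
have [N NE] := linear_pred_vspace subN.1.
have image W' (A : 'M[C]_(rdim W', rdim D)) (U' : {vspace 'cV[C]_(rdim W')}) :
    intertwines A -> irreducible_submodule U' -> A *m w \in U' -> A *m w != 0 ->
    (forall x, descendant w x -> A *m x = 0 -> x = 0) -> \dim U' = \dim N.
  move=> AZ irrU' wU' w0 injA; have [subU' _ _] := irrU'.
  pose f := linfun (mulmx A : 'cV[C]_(rdim D) -> 'cV[C]_(rdim W')).
  have fE x : f x = A *m x by rewrite lfunE.
  have -> : U' = (f @: N)%VS.
    apply/vspaceP => y; apply/idP/memv_imgP => [yU' | [x /NE dx ->]].
      have [|x dx ->] := irreducible_pred irrU' (intertwines_submodule AZ subN)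
        wU' w0 _ yU'; first by exists w => //; apply: Descendant_self.
      by exists x; [apply/NE | rewrite fE].
    by rewrite fE; apply: (descendant_image AZ subU' wU').
  rewrite limg_dim_eq //; apply/eqP; rewrite -subv0; apply/subvP => x.
  rewrite memv_cap memv_ker fE memv0 => /andP[/NE dx /eqP Ax].
  by rewrite (injA x).
rewrite -[rdim V]muln1 -[RHS](dim_matrix C (rdim V) 1) -dimvf.
rewrite (image _ A1 U) ?(image _ A2 fullv) ?Aw1 ?Aw2 //.
  apply: (diagonal_intertwiner_inj A2Z A1Z) irrU _ sw _ _; rewrite ?Aw1 ?Aw2 //.
  by move=> x ? ?; apply: inj.
by apply: (diagonal_intertwiner_inj A1Z A2Z) irrV _ sw _ _; rewrite ?Aw1 ?Aw2.
Qed.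

Lemma hw_module_dim_gt0 V kappa : hw_module V kappa -> (0 < rdim V)%N.
Proof.
move=> [_ [w _ [[w0 _] _]]]; rewrite lt0n; apply: contraNneq w0 => V0.
by apply/eqP/colP => i; have := ltn_ord i; rewrite {2}V0.
Qed.

End Intertwiners.

(** * The two summands of the tangent representation *)

(** These computations take place over any field of characteristic other than 2 with a
    square root [ii] of -1. *)
Definition isign (K : fieldType) (ii : K) s := if s then ii else - ii.

(** The rows are the null covectors x + i y ([s = true]) or x - i y on K^(2n).
    They vanish on the summand [~~ s] and are coordinates on the summand [s]. *)
Definition coframe (K : fieldType) (ii : K) n s : 'M[K]_(n, n + n) :=
  row_mx 1%:M (isign ii s)%:M.

(** [summand_mx s] is the embedding of End(K^n) as the endomorphisms of the
    summand [s], extended by zero on the other one. *)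
HB.lock Definition summand_mx (K : fieldType) (ii : K) n s (y : 'M[K]_n) :
    'M[K]_(n + n) :=
  2^-1 *: ((coframe ii n (~~ s))^T *m y *m coframe ii n s).

Section NullFrame.

Variables (K : fieldType) (ii : K) (n : nat).
Hypotheses (ii_sqr : ii * ii = -1) (two_unit : (2 : K) != 0).
Implicit Types (s : bool) (y z Z : 'M[K]_n).

Local Notation isign := (isign ii).
Local Notation coframe := (coframe ii n).
Local Notation summand_mx := (summand_mx ii).

Let isign_sqr s : isign s * isign s = -1.
Proof. by case: s; rewrite /= ?mulrNN. Qed.

Let isign_neg s : isign (~~ s) = - isign s.
Proof. by case: s; rewrite /= ?opprK. Qed.

Lemma coframe_isotropic s : coframe s *m (coframe s)^T = 0.
Proof.
rewrite tr_row_mx mul_row_col !tr_scalar_mx -!scalar_mxM isign_sqr mulr1.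
by rewrite -raddfD /= subrr raddf0.
Qed.

Lemma coframe_dual s : coframe s *m (coframe (~~ s))^T = 2%:M.
Proof.
rewrite tr_row_mx mul_row_col !tr_scalar_mx -!scalar_mxM isign_neg mulrN.
by rewrite isign_sqr mulr1 opprK -raddfD.
Qed.

Lemma coframe_complete s :
  (coframe (~~ s))^T *m coframe s + (coframe s)^T *m coframe (~~ s) = 2%:M.
Proof.
rewrite !tr_row_mx !mul_col_row add_block_mx !tr_scalar_mx -!scalar_mxM -!raddfD /=.
rewrite isign_neg !(mulr1, mul1r, mulrN, mulNr) !isign_sqr.
by rewrite addNr subrr opprK raddf0 -scalar_mx_block.
Qed.

Let summand_mxE := summand_mx.unlock.

Fact summand_mx_is_linear s : linear (summand_mx s : 'M_n -> 'M_(n + n)).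
Proof.
move=> a y z; rewrite summand_mxE mulmxDr mulmxDl scalerDr -scalemxAr -scalemxAl.
by rewrite !scalerA mulrC.
Qed.

HB.instance Definition _ s := GRing.isLinear.Build K 'M[K]_n 'M[K]_(n + n) *:%R
  (summand_mx s : 'M_n -> 'M_(n + n)) (summand_mx_is_linear s).

Lemma coframe_summand_mx s y : coframe s *m summand_mx s y = y *m coframe s.
Proof.
rewrite summand_mxE -scalemxAr !mulmxA coframe_dual -mulmxA mul_scalar_mx scalerA.
by rewrite mulVf // scale1r.
Qed.

Lemma coframe_summand_mx_neg s y : coframe s *m summand_mx (~~ s) y = 0.
Proof.
by rewrite summand_mxE -scalemxAr !mulmxA negbK coframe_isotropic !mul0mx scaler0.
Qed.

Lemma summand_mxM s y z : summand_mx s y *m summand_mx s z = summand_mx s (y *m z).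
Proof.
rewrite {1}summand_mxE -scalemxAl -mulmxA coframe_summand_mx.
by rewrite summand_mxE !mulmxA.
Qed.

Lemma summand_mxM_neg s y z : summand_mx s y *m summand_mx (~~ s) z = 0.
Proof.
rewrite {1}summand_mxE -scalemxAl -mulmxA coframe_summand_mx_neg.
by rewrite mulmx0 scaler0.
Qed.

Lemma summand_mxM_negl s y z : summand_mx (~~ s) y *m summand_mx s z = 0.
Proof. by rewrite -{2}[s]negbK summand_mxM_neg. Qed.

(** Transposition exchanges the summands, since each is isotropic: this is why the
    twist maps one family of projections to the other. *)
Lemma summand_mx_tr s y : (summand_mx s y)^T = summand_mx (~~ s) y^T.
Proof. by rewrite summand_mxE linearZ /= !trmx_mul trmxK negbK mulmxA. Qed.

Lemma mxtrace_summand_mx s y : \tr (summand_mx s y) = \tr y.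
Proof.
rewrite summand_mxE linearZ /= mxtrace_mulC mulmxA coframe_dual mul_scalar_mx linearZ /=.
by rewrite mulrA mulVf // mul1r.
Qed.

Definition summand_proj s := summand_mx s (1%:M : 'M[K]_n).

Lemma summand_mx_scalar s a : summand_mx s (a%:M : 'M[K]_n) = a *: summand_proj s.
Proof. by rewrite -scalemx1 linearZ. Qed.

Lemma summand_proj_sum s : summand_proj s + summand_proj (~~ s) = 1%:M.
Proof.
rewrite /summand_proj summand_mxE !mulmx1 negbK -scalerDr coframe_complete.
rewrite scale_scalar_mx.
by rewrite mulVf.
Qed.

Lemma summand_proj_conj s (x : 'M[K]_(n + n)) :
  summand_proj s *m x *m summand_proj s =
  summand_mx s (2^-1 *: (coframe s *m x *m (coframe (~~ s))^T)).
Proof.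
rewrite /summand_proj summand_mxE !mulmx1 -!(scalemxAl, scalemxAr) !scalerA.
congr (_ *: _).
by rewrite !mulmxA.
Qed.

(** The tangent representation in the null frame: Z on one summand, its dual on the
    other; see [tangentE]. *)
Definition frame_act Z := summand_mx true Z - summand_mx false Z^T.

Definition summand_act s Z := if s then Z else - Z^T.

Local Notation T := frame_act.

Lemma frame_act_block Z :
  T Z = block_mx (2^-1 *: (Z - Z^T)) (- (- (2^-1 * ii) *: (Z + Z^T)))
                 (- (2^-1 * ii) *: (Z + Z^T)) (2^-1 *: (Z - Z^T)).
Proof.
rewrite /frame_act summand_mxE /coframe -scalerBr.
rewrite !tr_row_mx !tr_scalar_mx [_ *m Z]mul_col_mx [_ *m Z^T]mul_col_mx.
rewrite !mul1mx !mul_col_row !mulmx1.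
rewrite opp_block_mx add_block_mx scale_block_mx !mul_scalar_mx !mul_mx_scalar !scalerA.
rewrite /isign /=; congr block_mx.
- by rewrite !scaleNr !opprK -scalerA -scalerDr.
- by rewrite !scaleNr -opprD -scalerDr scalerN scalerA.
- by rewrite mulrN mulNr ii_sqr opprK !scale1r.
Qed.

Lemma frame_act_delta i j :
  T (delta_mx i j) = summand_mx true (delta_mx i j) - summand_mx false (delta_mx j i).
Proof. by rewrite /frame_act trmx_delta. Qed.

Lemma frame_act_tr Z : (T Z)^T = - T Z.
Proof. by rewrite /frame_act linearB /= !summand_mx_tr trmxK opprB. Qed.

Lemma coframe_act s Z : coframe s *m T Z = summand_act s Z *m coframe s.
Proof.
rewrite /frame_act mulmxBr; case: s => /=.
  by rewrite (coframe_summand_mx true) (coframe_summand_mx_neg true) subr0.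
by rewrite (coframe_summand_mx false) (coframe_summand_mx_neg false) sub0r mulNmx.
Qed.

Lemma mxtrace_frame_act Y Z : \tr (T Y *m T Z) = 2 * \tr (Y *m Z).
Proof.
rewrite !/frame_act mulmxBl !mulmxBr !summand_mxM.
rewrite (summand_mxM_neg true) (summand_mxM_neg false).
rewrite subr0 sub0r opprK linearD /= !mxtrace_summand_mx -trmx_mul mxtrace_tr.
by rewrite [\tr (Z *m Y)]mxtrace_mulC mulrDl !mul1r.
Qed.

Lemma summand_proj_act s Z : summand_proj s *m T Z = T Z *m summand_proj s.
Proof.
rewrite /frame_act mulmxBl mulmxBr; case: s; rewrite !summand_mxM mulmx1 mul1mx.
  by rewrite (summand_mxM_neg true) (summand_mxM_negl true).
by rewrite (summand_mxM_neg false) (summand_mxM_negl false).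
Qed.

(** The central element 1 of gl_n acts by +1 and -1 on the summands, so equivariant maps
    respect the splitting; see [equivariant_type_proj]. *)
Lemma summand_projE s : summand_proj s = 2^-1 *: (1%:M + (-1) ^+ (~~ s) *: T 1%:M).
Proof.
have -> : T 1%:M = summand_proj true - summand_proj false by rewrite /frame_act trmx1.
rewrite -(summand_proj_sum true); have half (x : 'M[K]_(n + n)) : x = 2^-1 *: (x + x).
  by rewrite -[x in RHS]scale1r -scalerDl scalerA mulVf // scale1r.
rewrite {1}[summand_proj s]half; congr (_ *: _); case: s => /=.
  by rewrite scale1r addrACA subrr addr0.
by rewrite scaleN1r opprB [RHS]addrC addrA subrK.
Qed.

Lemma sum_delta_conj z :
  \sum_i \sum_j delta_mx i j *m z *m delta_mx j i = (\tr z)%:M :> 'M[K]_n.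
Proof.
have conjE i j : delta_mx i j *m z *m delta_mx j i = z j j *: delta_mx i i.
  apply/matrixP => k l; rewrite mxE (bigD1 j) //= big1 => [|m mj]; last first.
    by rewrite [X in _ * X]mxE (negPf mj) mulr0.
  rewrite addr0 mxE (bigD1 j) //= big1 => [|m mj]; last first.
    by rewrite mxE (negPf mj) andbF mul0r.
  by rewrite addr0 !mxE !eqxx andbT /= mulrAC mulrC -natrM mulnb.
rewrite scalar_mx_sum_delta; apply: eq_bigr => i _.
by rewrite /mxtrace scaler_suml; apply: eq_bigr => j _; apply: conjE.
Qed.

Lemma casimir_frame_act : \sum_i \sum_j T (delta_mx i j) *m T (delta_mx j i) = n%:R%:M.
Proof.
have E : \sum_i \sum_j delta_mx i j *m (delta_mx j i : 'M_n) = n%:R%:M :> 'M[K]_n.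
  have := sum_delta_conj 1%:M; rewrite mxtrace1 => <-.
  by apply: eq_bigr => i _; apply: eq_bigr => j _; rewrite mulmx1.
transitivity (summand_mx true n%:R%:M + summand_mx false n%:R%:M : 'M[K]_(n + n));
  last first.
  by rewrite !summand_mx_scalar -scalerDr (summand_proj_sum true) scalemx1.
rewrite -{1}E -E exchange_big /= [in X in _ + X]exchange_big /= exchange_big /=.
rewrite !linear_sum -big_split /=.
apply: eq_bigr => i _; rewrite !linear_sum -big_split /=; apply: eq_bigr => j _.
rewrite !frame_act_delta mulmxBl !mulmxBr !summand_mxM.
rewrite (summand_mxM_neg true) (summand_mxM_neg false).
by rewrite subr0 sub0r opprK.
Qed.

(** On End of one summand, sum_ij E_ij x E_ji = tr(x) 1.  This is the source of the
    partial trace in [ptranspose_casimir]. *)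
Lemma conj_frame_act s (x : 'M[K]_(n + n)) :
    summand_proj s *m x *m summand_proj s = x ->
  \sum_i \sum_j T (delta_mx i j) *m x *m T (delta_mx j i) = \tr x *: summand_proj s.
Proof.
rewrite summand_proj_conj; move: (_ *: _) => y <-.
rewrite mxtrace_summand_mx -summand_mx_scalar.
rewrite -sum_delta_conj; case: s.
  rewrite linear_sum; apply: eq_bigr => i _; rewrite linear_sum; apply: eq_bigr => j _.
  rewrite !frame_act_delta mulmxBl (summand_mxM_negl true) subr0 mulmxBr !summand_mxM.
  by rewrite (summand_mxM_neg true) subr0.
rewrite exchange_big /= linear_sum; apply: eq_bigr => i _.
rewrite linear_sum; apply: eq_bigr => j _.
rewrite !frame_act_delta mulmxBl (summand_mxM_neg true) sub0r mulNmx mulmxBr !summand_mxM.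
by rewrite (summand_mxM_neg false) sub0r opprK.
Qed.

End NullFrame.

Section Tangent.

Variables (R : realType) (n : nat).
Local Notation C := R[i].
Local Notation T := (tangent_rep R n).

Lemma i_sqr : 'i%C * 'i%C = -1 :> C.
Proof. by rewrite -expr2 sqr_i. Qed.

Lemma two_neq0 : (2 : C) != 0.
Proof. by rewrite pnatr_eq0. Qed.

Lemma tangentE Z : T Z = frame_act 'i%C Z.
Proof.
rewrite frame_act_block ?i_sqr // -[LHS]/(tangent_act Z) tangent_actE.
have i0 : 'i%C != 0 :> C by rewrite -sqrf_eq0 sqr_i oppr_eq0 oner_eq0.
suff -> : (2 * 'i%C)^-1 = - (2^-1 * 'i%C) :> C by [].
rewrite invfM -mulrN; congr (_ * _); apply: (mulIf i0).
by rewrite mulVf // mulNr i_sqr opprK.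
Qed.

Lemma trace_formE (Y Z : 'M[C]_n) : trace_form Y Z = - \tr (Y *m Z).
Proof. rewrite /trace_form tangentE (tangentE Z) (mxtrace_frame_act i_sqr two_neq0).
by rewrite mulrA mulNr mulVf ?two_neq0 // mulN1r. Qed.

End Tangent.

(** * Partial transposition and partial trace *)

Section Tensor.

Variables (K : fieldType).

Lemma tensmxDl m p q r (A A' : 'M[K]_(m, p)) (B : 'M[K]_(q, r)) :
  (A + A') *t B = A *t B + A' *t B.
Proof. by apply/matrixP => i j; rewrite !mxE mulrDl. Qed.

Lemma tensmxNl m p q r (A : 'M[K]_(m, p)) (B : 'M[K]_(q, r)) :
  (- A) *t B = - (A *t B).
Proof. by apply/matrixP => i j; rewrite !mxE mulNr. Qed.

Lemma tensmxZl m p q r a (A : 'M[K]_(m, p)) (B : 'M[K]_(q, r)) :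
  (a *: A) *t B = a *: (A *t B).
Proof. by apply/matrixP => i j; rewrite !mxE mulrA. Qed.

Lemma tensmxZr m p q r a (A : 'M[K]_(m, p)) (B : 'M[K]_(q, r)) :
  A *t (a *: B) = a *: (A *t B).
Proof. by apply/matrixP => i j; rewrite !mxE mulrCA. Qed.

Lemma tensmx_suml (I : finType) m p q r (A : I -> 'M[K]_(m, p)) (B : 'M[K]_(q, r)) :
  (\sum_i A i) *t B = \sum_i A i *t B.
Proof.
apply/matrixP => i j; rewrite mxE summxE mulr_suml summxE.
by apply: eq_bigr => k _; rewrite mxE.
Qed.

Lemma tensmx_sumr (I : finType) m p q r (A : 'M[K]_(m, p)) (B : I -> 'M[K]_(q, r)) :
  A *t (\sum_i B i) = \sum_i A *t B i.
Proof.
apply/matrixP => i j; rewrite mxE summxE mulr_sumr summxE.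
by apply: eq_bigr => k _; rewrite mxE.
Qed.

Lemma tensmxDr m p q r (A : 'M[K]_(m, p)) (B B' : 'M[K]_(q, r)) :
  A *t (B + B') = A *t B + A *t B'.
Proof. by apply/matrixP => i j; rewrite !mxE mulrDr. Qed.

Lemma tens1mx1 p q : (1%:M : 'M[K]_p) *t (1%:M : 'M_q) = 1%:M.
Proof.
apply/matrixP => x y; rewrite -[x]mxtens_unindexK -[y]mxtens_unindexK.
case: (mxtens_unindex x) (mxtens_unindex y) => i j [k l]; rewrite tensmxE !mxE.
by rewrite (can_eq (@mxtens_indexK _ _)) xpair_eqE -natrM mulnb.
Qed.

Lemma tens_ind p q (P : 'M[K]_(p * q) -> Prop) :
    (forall F G, P F -> P G -> P (F + G)) ->
    (forall (A : 'M_p) (B : 'M_q), P (A *t B)) ->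
  forall F, P F.
Proof.
move=> PD Pt F; rewrite [F]matrix_sum_delta.
have P0 : P 0 by have := Pt 0 0; rewrite tens0mx.
apply: (big_ind P) => // x _; apply: (big_ind P) => // y _.
rewrite -[x]mxtens_unindexK -[y]mxtens_unindexK.
case: (mxtens_unindex x) (mxtens_unindex y) => i j [k l].
suff -> : delta_mx (mxtens_index (i, j)) (mxtens_index (k, l)) =
    delta_mx i k *t delta_mx j l :> 'M[K]_(p * q) by rewrite -tensmxZl.
apply/matrixP => x' y'; rewrite -[x']mxtens_unindexK -[y']mxtens_unindexK.
case: (mxtens_unindex x') (mxtens_unindex y') => i' j' [k' l']; rewrite tensmxE !mxE.
rewrite !(can_eq (@mxtens_indexK _ _)) !xpair_eqE -natrM mulnb.
by congr (_%:R); congr nat_of_bool; rewrite andbACA.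
Qed.

Variables (p q : nat).
Implicit Types F G : 'M[K]_(p * q).

Definition ptranspose F : 'M[K]_(p * q) :=
  \matrix_(x, y) F (mxtens_index ((mxtens_unindex y).1, (mxtens_unindex x).2))
                   (mxtens_index ((mxtens_unindex x).1, (mxtens_unindex y).2)).

Fact ptranspose_is_linear : linear ptranspose.
Proof. by move=> a F G; apply/matrixP => x y; rewrite !mxE. Qed.

HB.instance Definition _ := GRing.isLinear.Build K 'M[K]_(p * q) 'M[K]_(p * q) *:%R
  ptranspose ptranspose_is_linear.

Lemma ptranspose_tens (A : 'M_p) (B : 'M_q) : ptranspose (A *t B) = A^T *t B.
Proof. by apply/matrixP => x y; rewrite !mxE !mxtens_indexK. Qed.

Definition ptrace F : 'M[K]_q :=
  \matrix_(i, j) \sum_k F (mxtens_index (k, i)) (mxtens_index (k, j)).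

Fact ptrace_is_linear : linear ptrace.
Proof.
move=> a F G; apply/matrixP => i j; rewrite !mxE mulr_sumr -big_split.
by apply: eq_bigr => k _; rewrite !mxE.
Qed.

HB.instance Definition _ := GRing.isLinear.Build K 'M[K]_(p * q) 'M[K]_q *:%R
  ptrace ptrace_is_linear.

Lemma ptrace_tens (A : 'M_p) (B : 'M_q) : ptrace (A *t B) = \tr A *: B.
Proof.
apply/matrixP => i j; rewrite !mxE mulr_suml; apply: eq_bigr => k _.
by rewrite tensmxE.
Qed.

Lemma mxtrace_tens (A : 'M[K]_p) (B : 'M[K]_q) : \tr (A *t B) = \tr A * \tr B.
Proof.
rewrite /mxtrace mulr_suml; under [RHS]eq_bigr => i _ do rewrite mulr_sumr.
rewrite pair_big (reindex (@mxtens_index p q)) /=.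
  by apply: eq_bigr => -[i j] _; rewrite tensmxE.
by exists (@mxtens_unindex p q) => x _; rewrite (mxtens_indexK, mxtens_unindexK).
Qed.

Lemma mxtrace_ptrace F : \tr (ptrace F) = \tr F.
Proof.
elim/tens_ind: F => [F G FE GE | A B]; first by rewrite !linearD /= FE GE.
by rewrite ptrace_tens linearZ mxtrace_tens.
Qed.

Lemma ptrace_commute F (B : 'M_q) :
  ptrace (F *m (1%:M *t B)) = ptrace F *m B /\
  ptrace ((1%:M *t B) *m F) = B *m ptrace F.
Proof.
elim/tens_ind: F => [F G [FE FE'] [GE GE'] | A B'].
  by rewrite mulmxDl !linearD /= FE GE FE' GE' mulmxDl.
by rewrite !tensmx_mul !ptrace_tens mulmx1 mul1mx -scalemxAl -scalemxAr.
Qed.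

Lemma ptrace_mulC F (A : 'M_p) : ptrace (F *m (A *t 1%:M)) = ptrace ((A *t 1%:M) *m F).
Proof.
elim/tens_ind: F => [F G FE GE | A' B].
  by rewrite mulmxDl mulmxDr !linearD /= FE GE.
by rewrite !tensmx_mul !ptrace_tens mulmx1 mul1mx mxtrace_mulC.
Qed.

Lemma ptranspose_mul F (A : 'M_p) (B : 'M_q) :
  ptranspose F *m (A *t B) = ptranspose ((A^T *t 1%:M) *m F *m (1%:M *t B)).
Proof.
elim/tens_ind: F => [F G FE GE | A' B'].
  by rewrite mulmxDr mulmxDl !linearD /= mulmxDl FE GE.
by rewrite !tensmx_mul !ptranspose_tens !tensmx_mul !(mulmx1, mul1mx) trmx_mul trmxK.
Qed.

Lemma ptranspose_mul1 F (A : 'M_p) :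
  ptranspose ((A *t 1%:M) *m F) = ptranspose F *m (A^T *t 1%:M).
Proof. by rewrite ptranspose_mul trmxK tens1mx1 mulmx1. Qed.

End Tensor.

Section Identity.

Variables (K : fieldType) (ii : K) (n q : nat).
Hypotheses (ii_sqr : ii * ii = -1) (two_unit : (2 : K) != 0).
Variable v : 'I_n -> 'I_n -> 'M[K]_q.
Local Notation T i j := (frame_act ii (delta_mx i j : 'M[K]_n)).
Local Notation summand_proj := (summand_proj ii n).
Local Notation tens1 A := (A *t (1%:M : 'M[K]_q)).
Local Notation idT := (1%:M : 'M[K]_(n + n)).

Definition casimir_pairing : 'M[K]_((n + n) * q) := \sum_i \sum_j T i j *t v j i.

Lemma conj_frame_act_tens s F :
    tens1 (summand_proj s) *m F *m tens1 (summand_proj s) = F ->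
  \sum_i \sum_j tens1 (T i j) *m F *m tens1 (T j i) = summand_proj s *t ptrace F.
Proof.
move=> <-; elim/tens_ind: F => [F G FE GE | A B].
  rewrite !(mulmxDl, mulmxDr) linearD /=.
  rewrite tensmxDr -FE -GE -big_split; apply: eq_bigr => i _; rewrite -big_split.
  by apply: eq_bigr => j _; rewrite mulmxDr mulmxDl.
rewrite !tensmx_mul !mul1mx !mulmx1 ptrace_tens tensmxZr -tensmxZl.
rewrite -(conj_frame_act ii_sqr two_unit (s := s)).
  rewrite tensmx_suml; apply: eq_bigr => i _; rewrite tensmx_suml; apply: eq_bigr => j _.
  by rewrite !tensmx_mul mul1mx mulmx1.
have pp : summand_proj s *m summand_proj s = summand_proj s.
  by rewrite (summand_mxM ii_sqr two_unit) mulmx1.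
by rewrite -!mulmxA pp !mulmxA pp.
Qed.

(** Move the right factor [v j i] across [F] by equivariance ([push]), and
    sum over i and j. *)
Lemma ptranspose_casimir s b F :
    (forall i j, F *m (tens1 (T i j) + idT *t v i j) =
                 (tens1 (T i j) + idT *t v i j) *m F) ->
    casimir_pairing *m F = b *: F ->
    tens1 (summand_proj s) *m F *m tens1 (summand_proj s) = F ->
  ptranspose F *m casimir_pairing =
    summand_proj (~~ s) *t ptrace F - (b + n%:R) *: ptranspose F.
Proof.
move=> eqF BF pFp.
have push i j : (tens1 (T i j) *m F *m (idT *t v j i)) =
    (T i j *t v j i) *m F + tens1 (T i j *m T j i) *m F
      - tens1 (T i j) *m F *m tens1 (T j i).
  have := eqF j i; rewrite mulmxDr addrC => /(canRL (addrK _)) E.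
  rewrite -mulmxA E mulmxBr mulmxDl mulmxDr !mulmxA !tensmx_mul !(mulmx1, mul1mx).
  by rewrite [X in X - _]addrC.
transitivity (- ptranspose (casimir_pairing *m F + n%:R *: F -
                            summand_proj s *t ptrace F)).
  have -> : n%:R *: F = \sum_i \sum_j tens1 (T i j *m T j i) *m F.
    rewrite -[F in LHS]mul1mx -tens1mx1 scalemxAl -tensmxZl scalemx1.
    rewrite -(casimir_frame_act _ ii_sqr two_unit) tensmx_suml mulmx_suml.
    by apply: eq_bigr => i _; rewrite tensmx_suml mulmx_suml.
  rewrite -(conj_frame_act_tens pFp) /casimir_pairing mulmx_suml -big_split -sumrB.
  rewrite mulmx_sumr linear_sum -sumrN; apply: eq_bigr => i _ /=.
  rewrite mulmx_suml -big_split -sumrB mulmx_sumr linear_sum -sumrN.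
  apply: eq_bigr => j _ /=; rewrite -push ptranspose_mul frame_act_tr.
  by rewrite tensmxNl !mulNmx linearN.
rewrite BF -scalerDl linearB linearZ /= ptranspose_tens.
by rewrite summand_mx_tr trmx1 opprB.
Qed.

End Identity.

(** * Singular vectors of the tensor product *)

Section Contraction.

Variables (K : fieldType) (p q : nat).
Implicit Types (tau : 'rV[K]_p) (w : 'cV[K]_(p * q)).

Definition contract tau w : 'cV[K]_q :=
  \col_j \sum_k tau 0 k * w (mxtens_index (k, j)) 0.

Fact contract_is_linear tau : linear (contract tau).
Proof.
move=> a w w'; apply/colP => j; rewrite !mxE mulr_sumr -big_split.
by apply: eq_bigr => k _; rewrite !mxE mulrDr mulrCA.
Qed.

HB.instance Definition _ tau := GRing.isLinear.Build K 'cV[K]_(p * q) 'cV[K]_q *:%R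
  (contract tau) (contract_is_linear tau).

Lemma contract_comb m (u : 'rV_m) (M : 'M_(m, p)) w :
  contract (u *m M) w = \sum_i u 0 i *: contract (row i M) w.
Proof.
apply/colP => j; rewrite summxE mxE.
under eq_bigr => k _ do rewrite mxE mulr_suml.
rewrite exchange_big; apply: eq_bigr => i _ /=; rewrite !mxE mulr_sumr.
by apply: eq_bigr => k _; rewrite !mxE mulrA.
Qed.

Lemma contractD tau tau' w : contract (tau + tau') w = contract tau w + contract tau' w.
Proof.
apply/colP => j; rewrite !mxE -big_split.
by apply: eq_bigr => k _; rewrite !mxE mulrDl.
Qed.

Lemma contractZ a tau w : contract (a *: tau) w = a *: contract tau w.
Proof.
by apply/colP => j; rewrite !mxE mulr_sumr; apply: eq_bigr => k _; rewrite !mxE mulrA.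
Qed.

Lemma tensmx_mul_cV (A : 'M_p) (B : 'M_q) w k j :
  ((A *t B) *m w) (mxtens_index (k, j)) 0 =
  \sum_k' \sum_j' A k k' * B j j' * w (mxtens_index (k', j')) 0.
Proof.
rewrite mxE pair_big (reindex (@mxtens_index p q)) /=.
  by apply: eq_bigr => -[k' j'] _; rewrite tensmxE.
by exists (@mxtens_unindex p q) => x _; rewrite (mxtens_indexK, mxtens_unindexK).
Qed.

Lemma contract_tens tau (A : 'M_p) (B : 'M_q) w :
  contract tau ((A *t B) *m w) = B *m contract (tau *m A) w.
Proof.
apply/colP => j; rewrite !mxE.
transitivity (\sum_k \sum_k' \sum_j'
    tau 0 k * (A k k' * B j j' * w (mxtens_index (k', j')) 0)).
  apply: eq_bigr => k _; rewrite tensmx_mul_cV mulr_sumr.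
  by apply: eq_bigr => k' _; rewrite mulr_sumr.
transitivity (\sum_j' \sum_k' \sum_k
    tau 0 k * (A k k' * B j j' * w (mxtens_index (k', j')) 0)).
  rewrite exchange_big /= [RHS]exchange_big; apply: eq_bigr => k' _.
  by rewrite exchange_big.
apply: eq_bigr => j' _; rewrite mxE mulr_sumr; apply: eq_bigr => k' _.
by rewrite mxE mulr_suml mulr_sumr; apply: eq_bigr => k _; ring.
Qed.

Lemma contract_ext w : (forall tau, contract tau w = 0) -> w = 0.
Proof.
move=> w0; apply/colP => x; rewrite -[x]mxtens_unindexK.
case: (mxtens_unindex x) => k j; have /colP/(_ j) := w0 (delta_mx 0 k).
rewrite !mxE (bigD1 k) //= big1 ?addr0 => [|l lk]; last first.
  by rewrite mxE (negPf lk) mul0r.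
by rewrite mxE !eqxx mul1r.
Qed.

End Contraction.

Section TensorSingular.

Variables (R : realType) (n : nat) (V : glrep R n) (lam : 'rV[int]_n).
Local Notation C := R[i].
Local Notation T := (tangent_rep R n).
Local Notation TV := (tens_rep T V).
Local Notation d := (rdim V).
Local Notation vec := 'cV[C]_((n + n) * d).
Local Notation coframe := (coframe ('i%C : C) n).
Local Notation weight kappa := (fun k : 'I_n => ((kappa : 'rV[int]_n) 0 k)%:~R : C).
Hypothesis hwV : hw_module V lam.
Implicit Types (s : bool) (i j k : 'I_n) (w : 'cV[C]_(rdim TV)).

Lemma tens_repE Z :
  TV Z = frame_act 'i%C Z *t (1%:M : 'M[C]_d) + (1%:M : 'M[C]_(n + n)) *t V Z.
Proof. by rewrite -tangentE. Qed.

(** The component of [w] in V along the tangent weight vector of weight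
    [tangent_wt s i], up to a factor 2. *)
Definition coord_at s i w : 'cV[C]_d := contract (row i (coframe s)) w.

Fact coord_at_is_linear s i : linear (coord_at s i).
Proof. exact: contract_is_linear. Qed.

HB.instance Definition _ s i := GRing.isLinear.Build C 'cV[C]_(rdim TV) 'cV[C]_d *:%R
  (coord_at s i) (coord_at_is_linear s i).

Lemma coord_at_tens1 s i (A : 'M[C]_(n + n)) w :
  coord_at s i ((A *t (1%:M : 'M[C]_d)) *m w) = contract (row i (coframe s *m A)) w.
Proof. by rewrite /coord_at contract_tens mul1mx -row_mul. Qed.

Lemma coord_at_1tens s i (B : 'M[C]_d) w :
  coord_at s i (((1%:M : 'M[C]_(n + n)) *t B) *m w) = B *m coord_at s i w.
Proof. by rewrite /coord_at contract_tens mulmx1. Qed.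

Lemma coord_at_delta s i a b w :
  coord_at s i (TV (delta_mx a b) *m w) =
  (if s then (i == a)%:R *: coord_at s b w else - ((i == b)%:R *: coord_at s a w)) +
  V (delta_mx a b) *m coord_at s i w.
Proof.
rewrite tens_repE mulmxDl linearD /= coord_at_tens1 coord_at_1tens; congr (_ + _).
rewrite (coframe_act (i_sqr R) (two_neq0 R)).
have row_delta c e (M : 'M[C]_(n, n + n)) :
    row i (delta_mx c e *m M) = (i == c)%:R *: row e M.
  rewrite row_mul; apply/rowP => l; rewrite !mxE (bigD1 e) //= big1 ?addr0.
    by rewrite !mxE eqxx andbT.
  by move=> m me; rewrite !mxE (negPf me) andbF mul0r.
case: s => /=; first by rewrite row_delta contractZ.
rewrite trmx_delta mulNmx -scaleN1r linearZ /= row_delta !contractZ.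
by rewrite scaleN1r.
Qed.

Lemma coord_at_ext w : (forall s i, coord_at s i w = 0) -> w = 0.
Proof.
move=> w0; apply: contract_ext => tau.
have tauE : 2%:R *: tau = tau *m (coframe false)^T *m coframe true +
    tau *m (coframe true)^T *m coframe false.
  by rewrite -!mulmxA -mulmxDr (coframe_complete n (i_sqr R) true) mul_mx_scalar.
have zero s (u : 'rV_n) : contract (u *m coframe s) w = 0.
  by rewrite contract_comb big1 // => i _; rewrite [contract _ _]w0 scaler0.
have /eqP : 2%:R *: contract tau w = 0 by rewrite -contractZ tauE contractD !zero addr0.
by rewrite scaler_eq0 (negPf (two_neq0 R)) => /eqP.
Qed.

Definition tangent_wt s i : 'rV[int]_n := if s then eps i else - eps i.

Lemma tangent_wt_inj s s' i i' : tangent_wt s i = tangent_wt s' i' -> s = s' /\ i = i'.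
Proof.
move=> /rowP/(_ i); rewrite /tangent_wt /eps.
by case: s; case: s'; rewrite !mxE !eqxx /=; case: (eqVneq i i') => [<-|].
Qed.

Lemma weight_tangent_wt_inj s s' i i' :
    (forall k, weight (lam + tangent_wt s i) k = weight (lam + tangent_wt s' i') k) ->
  s = s' /\ i = i'.
Proof.
move=> wE; apply: tangent_wt_inj; apply/rowP => k; have /intr_inj := wE k.
by rewrite [LHS]mxE [RHS]mxE => /addrI.
Qed.

(** Within the summand [s], the tangent weight of [i'] is lower than that of [i]: raising
    operators move the component at [i'] to the one at [i]. *)
Definition lower_wt s i i' := if s then (i < i')%N else (i' < i)%N.

(** A raising operator of gl_n applied to [w] changes the component at [i] only by V's
    raising operator and by components at lower tangent weights, which vanish here. *)
Lemma singular_coord_at chi s i w : singular (W := TV) chi w ->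
    (forall i', lower_wt s i i' -> coord_at s i' w = 0) ->
  singular (fun k => chi k - weight (tangent_wt s i) k) (coord_at s i w).
Proof.
move=> [wk wij] top; split=> [k | a b ab].
  have := coord_at_delta s i k k w; rewrite wk linearZ /= => /esym/(canRL (addKr _)) ->.
  rewrite addrC scalerBl; congr (_ - _).
  rewrite /tangent_wt /eps; case: (s); rewrite !mxE /= [k == i]eq_sym.
    by case: eqVneq => [->|]; rewrite ?scale0r ?scale1r.
  by case: eqVneq => [->|]; rewrite ?scale0r ?scale1r ?oppr0 ?scaleN1r ?scale0r.
have := coord_at_delta s i a b w; rewrite wij // linear0 => /esym.
case: s top => /= top; case: eqVneq => [iE|_]; rewrite ?scale0r ?oppr0 ?add0r //.
  by rewrite top ?scaler0 ?add0r // iE.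
by rewrite top ?scaler0 ?oppr0 ?add0r // iE.
Qed.

Lemma singular_weight chi (v : 'cV[C]_d) :
  singular (W := V) chi v -> v != 0 -> forall k, chi k = weight lam k.
Proof.
move=> sv v0 k; have [irrV [u uV /highest_weight_vectorP[u0 su]]] := hwV.
have [a vE] := irreducible_singular_unique irrV uV (memvf v) u0 su sv.
have /eqP := sv.1 k; rewrite vE -scalemxAr su.1 !scalerA -subr_eq0 -scalerBl.
rewrite scaler_eq0 (negPf u0) orbF mulrC -mulrBl mulf_eq0.
have /negPf -> : a != 0 by apply: contraNneq v0 => a0; rewrite vE a0 scale0r.
by rewrite orbF subr_eq0 => /eqP.
Qed.

(** Going up from the lowest tangent weight, the first nonzero component is
    singular in V, so it has weight lam and determines the weight of [w]. *)
Lemma coord_at_vanish chi s i w : singular (W := TV) chi w ->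
    (forall j, j = i \/ lower_wt s i j ->
       (forall k, chi k = weight (lam + tangent_wt s j) k) ->
       coord_at s j w = 0) ->
  coord_at s i w = 0.
Proof.
move=> sw; pose m j := if s then (n - j)%N else nat_of_ord j.
have [N] := ubnP (m i); elim: N i => // N IH i; rewrite ltnS => leN hyp.
have top i' : lower_wt s i i' -> coord_at s i' w = 0.
  move=> ii'; apply: IH => [|j ji'].
    apply: leq_trans leN; move: ii' (ltn_ord i'); rewrite /m /lower_wt; case: (s); lia.
  apply: hyp; right; case: ji' => [-> // |]; move: ii'; rewrite /lower_wt.
  by case: (s); [apply: ltn_trans | move=> /[swap]; apply: ltn_trans].
apply/eqP; apply: contraT => c0; move/eqP: (c0); case; apply: hyp; first by left.
move=> k; have /eqP := singular_weight (singular_coord_at sw top) c0 k.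
by rewrite subr_eq => /eqP ->; rewrite mxE rmorphD.
Qed.

Lemma tensor_singular_weight chi w : singular (W := TV) chi w -> w != 0 ->
  exists s i, forall k, chi k = weight (lam + tangent_wt s i) k.
Proof.
move=> sw w0; apply: boolp.contrapT => none; move/eqP: w0; apply.
apply: coord_at_ext => s i; apply: (coord_at_vanish sw) => j _ chiE.
by case: none; exists s, j.
Qed.

Section OneWeight.
Variables (s : bool) (i : 'I_n).
Let chi := weight (lam + tangent_wt s i).

Lemma coord_at_neg w s' j : singular (W := TV) chi w -> s' != s -> coord_at s' j w = 0.
Proof.
move=> sw ss'; apply: (coord_at_vanish sw) => k _ /weight_tangent_wt_inj[sE].
by rewrite sE eqxx in ss'.
Qed.

Lemma coord_at_lower w i' : singular (W := TV) chi w -> lower_wt s i i' ->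
  coord_at s i' w = 0.
Proof.
move=> sw ii'; apply: (coord_at_vanish sw) => j ji' /weight_tangent_wt_inj[_ ij].
exfalso; move: ji' ii'; rewrite -ij /lower_wt => -[<-|]; case: (s); lia.
Qed.

Lemma tensor_singular_eq0 w : singular (W := TV) chi w -> coord_at s i w = 0 -> w = 0.
Proof.
move=> sw c0; apply: coord_at_ext => s' j; apply: (coord_at_vanish sw) => k _.
by move=> /weight_tangent_wt_inj[<- <-].
Qed.

(** The components at (s, i) are highest weight vectors of V, hence proportional; a
    combination of the two vectors in which they cancel is zero. *)
Lemma tensor_singular_unique w w' :
    singular (W := TV) chi w -> singular (W := TV) chi w' -> w != 0 ->
  exists a, w' = a *: w.
Proof.
move=> sw sw' w0; have [irrV _] := hwV.
have top u : singular (W := TV) chi u ->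
    forall i', lower_wt s i i' -> coord_at s i' u = 0.
  by move=> su i'; apply: coord_at_lower.
have c0 : coord_at s i w != 0.
  by apply: contraNneq w0 => /(tensor_singular_eq0 sw) ->.
have [a aE] := irreducible_singular_unique irrV (memvf _) (memvf (coord_at s i w')) c0
  (singular_coord_at sw (top _ sw)) (singular_coord_at sw' (top _ sw')).
exists a; apply/eqP; rewrite -subr_eq0; apply/eqP; apply: tensor_singular_eq0.
  have lin := linear_pred_singular TV chi.
  exact: linear_predB lin _ _ sw' (linear_predZ lin a sw).
by rewrite linearB linearZ /= aE subrr.
Qed.

End OneWeight.

End TensorSingular.

Section Operators.

Variables (R : realType) (n : nat) (V : glrep R n).
Local Notation C := R[i].
Local Notation TV := (tens_rep (tangent_rep R n) V).
Local Notation d := (rdim V).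

Lemma twistE (F : 'M[C]_(rdim TV)) : twist F = ptranspose (p := n + n) (q := d) F.
Proof.
have entry (G : 'M[C]_(rdim TV)) k l i j :
    G (mxtens_index (k, i)) (mxtens_index (l, j)) =
    component G (delta_mx k 0) (delta_mx l 0) i j.
  rewrite componentE (bigD1 k) //= (bigD1 l) //= !big1 ?addr0.
  - by rewrite !mxE !eqxx mul1r mulr1.
  - by move=> m mk; rewrite big1 // => m' _; rewrite mxE (negPf mk) !mul0r.
  - by move=> m ml; rewrite [X in _ * X]mxE (negPf ml) mulr0.
apply/matrixP => x y; rewrite -[x]mxtens_unindexK -[y]mxtens_unindexK.
case: (mxtens_unindex x) (mxtens_unindex y) => k i [l j].
by rewrite entry component_twist -entry [RHS]mxE !mxtens_indexK.
Qed.

(** The bases E_ij and -E_ji are dual for the trace form -tr(XY), so the invariant tensor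
    sum_a X_a (x) X_a equals - sum_ij E_ij (x) E_ji. *)
Lemma conformal_weight_opE (X : (n * n).-tuple 'M[C]_n) : orthonormal_basis X ->
  conformal_weight_op V X = casimir_pairing 'i%C (fun i j => V (delta_mx i j)).
Proof.
move=> [bX oX]; rewrite /conformal_weight_op /casimir_pairing.
pose beta (Y Z : 'M[C]_n) : 'M[C]_((n + n) * d) := frame_act 'i%C Y *t V Z.
have -> : \sum_a tangent_rep R n (tnth X a) *t V (tnth X a) =
    \sum_a beta (tnth X a) (tnth X a) by apply: eq_bigr => a _; rewrite tangentE.
have betaZ (I : finType) (c : I -> C) (Y : I -> 'M[C]_n) Z :
    beta (\sum_a c a *: Y a) Z = \sum_a c a *: beta (Y a) Z.
  rewrite /beta -tangentE linear_sum tensmx_suml; apply: eq_bigr => a _.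
  by rewrite linearZ tensmxZl tangentE.
have deltaE i j : delta_mx i j = \sum_a (- tnth X a j i) *: tnth X a.
  have dE := coord_basis bX (memvf (delta_mx i j : 'M[C]_n)).
  rewrite {1}dE; apply: eq_bigr => a _; rewrite -tnth_nth; congr (_ *: _).
  have : \tr (delta_mx i j *m tnth X a) = tnth X a j i.
    rewrite /mxtrace (bigD1 i) //= big1 => [|k ki]; last first.
      by rewrite mxE big1 // => l _; rewrite mxE (negPf ki) mul0r.
    rewrite addr0 mxE (bigD1 j) //= big1 => [|l lj]; last first.
      by rewrite mxE (negPf lj) andbF mul0r.
    by rewrite mxE !eqxx mul1r addr0.
  rewrite {1}dE mulmx_suml raddf_sum /= (bigD1 a) //= big1 => [|c ca]; last first.
    rewrite -scalemxAl linearZ /= -tnth_nth -[\tr _]opprK -trace_formE oX.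
    by rewrite (negPf ca) oppr0 mulr0.
  rewrite -scalemxAl linearZ /= -tnth_nth -[\tr _]opprK -trace_formE oX.
  rewrite eqxx addr0 => <-.
  by rewrite mulrN1 opprK.
have betaXX a : beta (tnth X a) (tnth X a) =
    \sum_i \sum_j tnth X a j i *: beta (tnth X a) (delta_mx j i).
  rewrite exchange_big {2}[tnth X a]matrix_sum_delta /beta linear_sum tensmx_sumr.
  apply: eq_bigr => j _ /=; rewrite linear_sum tensmx_sumr; apply: eq_bigr => i _ /=.
  by rewrite linearZ tensmxZr.
transitivity (\sum_a \sum_i \sum_j (- tnth X a j i) *: beta (tnth X a) (delta_mx j i)).
  rewrite -sumrN; apply: eq_bigr => a _; rewrite betaXX -sumrN; apply: eq_bigr => i _.
  by rewrite -sumrN; apply: eq_bigr => j _; rewrite scaleNr.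
rewrite exchange_big; apply: eq_bigr => i _.
rewrite exchange_big; apply: eq_bigr => j _ /=.
by rewrite -betaZ -deltaE.
Qed.

End Operators.

(** * The invariant projections *)

Section Projections.

Variables (R : realType) (n : nat) (V : glrep R n) (lam : 'rV[int]_n).
Local Notation C := R[i].
Local Notation T := (tangent_rep R n).
Local Notation TV := (tens_rep T V).
Local Notation d := (rdim V).
Local Notation weight kappa := (fun k : 'I_n => ((kappa : 'rV[int]_n) 0 k)%:~R : C).
Hypothesis hwV : hw_module V lam.
Implicit Types (s : bool) (i j k : 'I_n) (w x y : 'cV[C]_(rdim TV)).

Lemma tangent_weight s i : is_weight T (tangent_wt s i).
Proof.
pose cf s := coframe ('i%C : C) n s.
exists ((cf (~~ s))^T *m delta_mx i 0); split.
  apply/eqP => /(congr1 (mulmx (cf s))).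
  rewrite mulmxA (coframe_dual n (i_sqr R)) mul_scalar_mx mulmx0 => /colP/(_ i).
  by rewrite !mxE !eqxx mulr1 => /eqP; rewrite (negPf (two_neq0 R)).
move=> k; rewrite tangentE mulmxA.
have -> : frame_act 'i%C (delta_mx k k) *m (cf (~~ s))^T =
    (cf (~~ s))^T *m (if s then delta_mx k k else - delta_mx k k).
  apply: trmx_inj; rewrite !trmx_mul !trmxK frame_act_tr mulmxN.
  rewrite (coframe_act (i_sqr R) (two_neq0 R)) -mulNmx; congr (_ *m _).
  by case: (s); rewrite /= ?opprK ?linearN /= trmx_delta.
rewrite -mulmxA scalemxAr; congr (_ *m _).
rewrite /tangent_wt /eps; case: (s); rewrite ?mulNmx mul_delta_mx_cond !mxE eqxx /=.
  by case: eqVneq => [->|_]; rewrite ?scale1r ?scale0r.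
by case: eqVneq => [->|_]; rewrite ?scaleN1r ?mulr0n ?oppr0 ?scale0r.
Qed.

Definition type_proj s : 'M[C]_(rdim TV) :=
  summand_proj ('i%C : C) n s *t (1%:M : 'M[C]_d).

Lemma type_proj_idem s : type_proj s *m type_proj s = type_proj s.
Proof.
by rewrite tensmx_mul mulmx1 (summand_mxM (i_sqr R) (two_neq0 R)) mulmx1.
Qed.

Lemma type_proj_equivariant s : equivariant (type_proj s).
Proof.
move=> Z; rewrite tens_repE mulmxDl mulmxDr !tensmx_mul !(mulmx1, mul1mx).
by rewrite (summand_proj_act (i_sqr R) (two_neq0 R)).
Qed.

Lemma coord_at_type_proj s s' i w :
  coord_at s' i (type_proj s *m w) = if s == s' then coord_at s' i w else 0.
Proof.
rewrite coord_at_tens1.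
have -> : coframe 'i%C n s' *m summand_proj ('i%C : C) n s =
    if s == s' then coframe 'i%C n s' else 0.
  case: eqVneq => [->|ss'].
    by rewrite (coframe_summand_mx (i_sqr R) (two_neq0 R)) mul1mx.
  have -> : s = ~~ s' by case: (s) (s') ss' => -[].
  by rewrite (coframe_summand_mx_neg (i_sqr R)).
case: eqP => // _; rewrite row0.
by apply/colP => l; rewrite !mxE big1 // => k _; rewrite mxE mul0r.
Qed.

Lemma type_projE s :
  type_proj s = 2^-1 *: (1%:M + (-1) ^+ (~~ s) *: (frame_act 'i%C 1%:M *t 1%:M)).
Proof.
rewrite /type_proj (summand_projE n (i_sqr R) (two_neq0 R)) tensmxZl tensmxDl tens1mx1.
by rewrite tensmxZl.
Qed.

(** The projection onto a summand is a polynomial in T(1) (x) 1, and this operator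
    differs from the action of the central element 1 on T (x) V by a scalar. *)
Lemma equivariant_type_proj s (F : 'M[C]_(rdim TV)) : equivariant F ->
  F *m type_proj s = type_proj s *m F.
Proof.
move=> eqF.
have V1 : equivariant (V 1%:M).
  move=> Z; apply/eqP; rewrite -subr_eq0; apply/eqP.
  rewrite -[LHS]/(lie_bracket _ _) -ract_bracket /lie_bracket.
  by rewrite mul1mx mulmx1 subrr linear0.
have [c V1E] := equivariant_scalar hwV V1.
have T1E : frame_act 'i%C 1%:M *t 1%:M = TV 1%:M - c%:M :> 'M[C]_(rdim TV).
  have -> : c%:M = (1%:M : 'M[C]_(n + n)) *t (c%:M : 'M[C]_d).
    by rewrite -[c%:M in RHS]scalemx1 tensmxZr tens1mx1 scalemx1.
  by rewrite tens_repE V1E addrK.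
rewrite type_projE T1E -scalemxAr -scalemxAl mulmxDr mulmxDl mulmx1 mul1mx.
rewrite -scalemxAr -scalemxAl mulmxBr mulmxBl eqF mul_scalar_mx mul_mx_scalar //.
Qed.

Lemma singular_type_proj s i w :
  singular (W := TV) (weight (lam + tangent_wt s i)) w -> type_proj s *m w = w.
Proof.
move=> sw; apply/eqP; rewrite -subr_eq0; apply/eqP; apply: coord_at_ext => s' j.
rewrite linearB /= coord_at_type_proj; case: eqVneq => [_|ss']; first by rewrite subrr.
by rewrite (coord_at_neg hwV j sw) ?subrr // eq_sym.
Qed.

Variable pr : 'rV[int]_n -> 'M[C]_(rdim TV).
Hypothesis hpr : forall e, relevant V lam e -> invariant_projection (lam + e) (pr e).
Local Notation rel s i := (relevant V lam (tangent_wt s i)).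
Local Notation prt s i := (pr (tangent_wt s i)).

Lemma pr_spec s i : rel s i -> exists U w,
  [/\ irreducible_submodule U, w \in U, w != 0,
      singular (W := TV) (weight (lam + tangent_wt s i)) w &
      (forall x, prt s i *m x \in U) /\ forall u, u \in U -> prt s i *m u = u].
Proof.
move=> /hpr[_ [U [irrU [w wU /highest_weight_vectorP[w0 sw]]] UP]].
by exists U, w.
Qed.

Lemma pr_equivariant s i : rel s i -> equivariant (prt s i).
Proof. by move=> /hpr[]. Qed.

Lemma pr_singular s i w : rel s i ->
  singular (W := TV) (weight (lam + tangent_wt s i)) w -> prt s i *m w = w.
Proof.
move=> /pr_spec[U [u [irrU uU u0 su [_ Pid]]]] sw.
have [a ->] := tensor_singular_unique hwV su sw u0.
by rewrite -scalemxAr Pid.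
Qed.

Lemma pr_idem s i : rel s i -> prt s i *m prt s i = prt s i.
Proof.
move=> /pr_spec[U [u [_ _ _ _ [PU Pid]]]]; apply: mulmx_cV_ext => x.
by rewrite -mulmxA Pid.
Qed.

Lemma pr_neq0 s i : rel s i -> prt s i != 0.
Proof.
move=> ri; have [U [u [_ _ u0 su _]]] := pr_spec ri.
by apply: contraNneq u0 => P0; rewrite -(pr_singular ri su) P0 mul0mx.
Qed.

(** The image of [pr] is irreducible, so a submodule containing its highest weight
    vector contains all of it. *)
Lemma pr_on_image s i (Q : 'cV[C]_(rdim TV) -> Prop) : rel s i ->
    submodule_pred (W := TV) Q ->
    (forall w, singular (W := TV) (weight (lam + tangent_wt s i)) w -> Q w) ->
  forall x, Q (prt s i *m x).
Proof.
move=> /pr_spec[U [u [irrU uU u0 su [PU _]]]] subQ Qs x.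
exact: irreducible_pred irrU subQ uU u0 (Qs u su) _ (PU x).
Qed.

Lemma type_proj_pr s i : rel s i -> type_proj s *m prt s i = prt s i.
Proof.
move=> ri; apply: mulmx_cV_ext => x; rewrite -mulmxA.
rewrite -[RHS]scale1r.
apply: (pr_on_image ri (submodule_pred_fix 1 (type_proj_equivariant s))).
by move=> w sw; rewrite scale1r (singular_type_proj sw).
Qed.

Lemma pr_type_proj s i : rel s i -> prt s i *m type_proj s = prt s i.
Proof.
by move=> ri; rewrite (equivariant_type_proj s (pr_equivariant ri)) type_proj_pr.
Qed.

Lemma pr_orth s i j : rel s i -> rel s j -> i != j -> prt s i *m prt s j = 0.
Proof.
move=> ri rj ij; apply: mulmx_cV_ext => x; rewrite -mulmxA mul0mx.
apply: (pr_on_image rj (intertwines_ker (D := TV) (W := TV) (pr_equivariant ri))) => w sw.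
have [U [u [irrU uU u0 su [PU _]]]] := pr_spec ri.
have sPw := intertwines_singular (D := TV) (W := TV) (pr_equivariant ri) sw.
apply/eqP; apply: contraT => Pw0.
have [a PwE] := irreducible_singular_unique irrU uU (PU w) u0 su sPw.
have [k|_ ijE] := @weight_tangent_wt_inj R _ lam s s i j;
  last by rewrite ijE eqxx in ij.
have /eqP := sPw.1 k; rewrite {1}PwE -scalemxAr su.1 !scalerA mulrC -scalerA -PwE.
by rewrite -subr_eq0 -scalerBl scaler_eq0 (negPf Pw0) orbF subr_eq0 => /eqP.
Qed.

Lemma pr_dominant s i : rel s i -> dominant (lam + tangent_wt s i).
Proof. by move=> /pr_spec[U [u [_ _ u0 su _]]]; apply: singular_dominant su. Qed.

(** A minimal submodule supplies both the singular vector and the irreducible module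
    that makes its weight relevant. *)
Lemma singular_relevant s Q x : submodule_pred (W := TV) Q -> Q x -> x != 0 ->
    (forall y, Q y -> type_proj s *m y = y) ->
  exists i w, [/\ rel s i, singular (W := TV) (weight (lam + tangent_wt s i)) w,
                  Q w & w != 0].
Proof.
move=> subQ Qx x0 Qs; have [U irrU UQ] := irreducible_in_pred subQ x0 Qx.
have [subU U0 _] := irrU.
have [u uU u0] : exists2 u, u \in U & u != 0.
  by exists (vpick U); [apply: memv_pick | rewrite vpick0].
have [chi [w [w0 wU sw]]] := exists_singular (submodule_pred_mem subU) u0 uU.
have [s' [i chiE]] := tensor_singular_weight hwV sw w0.
have {}sw : singular (W := TV) (weight (lam + tangent_wt s' i)) w.
  by split=> [k|]; [rewrite sw.1 chiE | apply: sw.2].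
have ss' : s' = s.
  apply: contra_neq_eq w0 => ss'; apply: (tensor_singular_eq0 hwV sw).
  by rewrite -(Qs w (UQ w wU)) coord_at_type_proj eq_sym (negPf ss').
move: sw; rewrite ss' => sw; exists i, w; split=> //; last exact: UQ.
split; first exact: tangent_weight.
by exists U; split=> //; exists w => //; apply/highest_weight_vectorP.
Qed.

(** If [P], the sum, differed from the projection onto the summand, the vectors of the
    summand annihilated by [P] would form a nonzero submodule.  It contains a
    singular vector [w] of a relevant weight; the corresponding projection fixes
    [w], although it factors through [P]. *)
Lemma sum_pr s : \sum_(i | `[< rel s i >]) prt s i = type_proj s.
Proof.
set P := \sum_(i | _) _.
have prP i : rel s i -> prt s i *m P = prt s i.
  move=> ri; rewrite mulmx_sumr (bigD1 i) /=; last exact/asboolP.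
  rewrite pr_idem // big1 ?addr0 // => j /andP[/asboolP rj ji].
  by apply: pr_orth; rewrite // eq_sym.
have PP : P *m P = P by rewrite {1}/P mulmx_suml; apply: eq_bigr => i /asboolP/prP.
have sP : type_proj s *m P = P.
  by rewrite mulmx_sumr; apply: eq_bigr => i /asboolP/type_proj_pr.
have eqP' : equivariant P.
  move=> Z; rewrite mulmx_suml mulmx_sumr; apply: eq_bigr => i /asboolP ri.
  exact: pr_equivariant.
have Ps : P *m type_proj s = P by rewrite equivariant_type_proj.
(* the submodule of vectors of the summand that the sum misses *)
pose Q x := P *m x = 0 /\ type_proj s *m x = 1 *: x.
have subQ : submodule_pred (W := TV) Q.
  apply: submodule_pred_and; first exact: (intertwines_ker (D := TV) (W := TV)).
  exact/submodule_pred_fix/type_proj_equivariant.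
apply/eqP; rewrite -subr_eq0; apply/eqP; apply: mulmx_cV_ext => x; rewrite mul0mx.
apply/eqP; apply: contraT => Qx0.
have Qx : Q ((P - type_proj s) *m x).
  by split; rewrite ?scale1r mulmxA mulmxBr ?PP ?Ps ?subrr ?mul0mx // sP type_proj_idem.
have [|i [w [ri sw [Pw _] /eqP[]]]] := singular_relevant subQ Qx Qx0 (s := s).
  by move=> y [_]; rewrite scale1r.
by rewrite -(pr_singular ri sw) -prP // -mulmxA Pw mulmx0.
Qed.

Lemma pr_lin_indep s (c c' : 'I_n -> C) :
    \sum_(i | `[< rel s i >]) c i *: prt s i =
    \sum_(i | `[< rel s i >]) c' i *: prt s i ->
  forall i, rel s i -> c i = c' i.
Proof.
move=> cE i ri; move/(congr1 (mulmx (prt s i))): cE.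
have E a : prt s i *m (\sum_(i | `[< rel s i >]) a i *: prt s i) = a i *: prt s i.
  rewrite mulmx_sumr (bigD1 i) /=; last exact/asboolP.
  rewrite -scalemxAr pr_idem // big1 ?addr0 // => j /andP[/asboolP rj ji].
  by rewrite -scalemxAr pr_orth ?scaler0 // eq_sym.
rewrite !E => /eqP; rewrite -subr_eq0 -scalerBl scaler_eq0 (negPf (pr_neq0 ri)) orbF.
by rewrite subr_eq0 => /eqP.
Qed.

(** The partial trace of an equivariant operator is equivariant, hence a scalar;
    its trace is the dimension of the image of [pr]. *)
Lemma ptrace_pr s i (V' : glrep R n) : rel s i -> hw_module V' (lam + tangent_wt s i) ->
  ptrace (p := n + n) (q := d) (prt s i) = ((rdim V')%:R / d%:R)%:M.
Proof.
move=> ri hV'; have d0 := hw_module_dim_gt0 hwV.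
have [U [u [irrU uU u0 su [PU Pid]]]] := pr_spec ri.
have dimU : \dim U = rdim V'.
  apply: dim_hw_submodule hV'; split=> //; exists u => //.
  exact/highest_weight_vectorP.
have eqS : equivariant (V := V) (ptrace (p := n + n) (q := d) (prt s i)).
  move=> Z; have := pr_equivariant ri Z; rewrite tens_repE mulmxDl mulmxDr.
  move=> /(congr1 (@ptrace _ (n + n) d)); rewrite !linearD /= ptrace_mulC.
  by move=> /addrI; rewrite (ptrace_commute _ _).1 (ptrace_commute _ _).2.
have [a aE] := equivariant_scalar hwV eqS.
have := trace_projection PU Pid; rewrite dimU -mxtrace_ptrace aE mxtrace_scalar => <-.
by rewrite -[a *+ d]mulr_natr mulfK // pnatr_eq0 -lt0n.
Qed.

End Projections.

(** * The twist of the projections *)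

Section Twist.

Variables (R : realType) (n : nat) (V : 'rV[int]_n -> glrep R n).
Hypothesis hV : forall kappa, dominant kappa -> hw_module (V kappa) kappa.
Variable lam : 'rV[int]_n.
Hypothesis hlam : dominant lam.
Local Notation C := R[i].
Local Notation TV := (tens_rep (tangent_rep R n) (V lam)).
Local Notation d := (rdim (V lam)).
Variable pr : 'rV[int]_n -> 'M[C]_(rdim TV).
Hypothesis hpr : forall e, relevant (V lam) lam e ->
  invariant_projection (lam + e) (pr e).
Variable X : (n * n).-tuple 'M[C]_n.
Hypothesis hX : orthonormal_basis X.
Variable b : 'rV[int]_n -> C.
Hypothesis hb : forall e, relevant (V lam) lam e ->
  conformal_weight_op (V lam) X *m pr e = b e *: pr e.
Local Notation rel s i := (relevant (V lam) lam (tangent_wt s i)).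
Local Notation prt s i := (pr (tangent_wt s i)).
Let hwV := hV hlam.

Definition twist_coef s i j : C :=
  1 / (b (tangent_wt s i) + b (tangent_wt (~~ s) j) + n%:R) *
  ((rdim (V (lam + tangent_wt s i)))%:R / d%:R).

(** The denominator is nonzero because the dimension ratio and the projection on the
    right of (b + b' + n) twist(pr_e) pr_e' = ratio pr_e' are. *)
Lemma twist_pr_mul s i j : rel s i -> rel (~~ s) j ->
  twist (prt s i) *m prt (~~ s) j = twist_coef s i j *: prt (~~ s) j.
Proof.
move=> ri rj; have eqP' := pr_equivariant hpr ri.
have hV' := hV (pr_dominant hpr ri).
have BF := hb ri; rewrite (conformal_weight_opE _ hX) in BF.
have eqF k l :
    prt s i *m (frame_act 'i%C (delta_mx k l) *t 1%:M + 1%:M *t V lam (delta_mx k l)) =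
    (frame_act 'i%C (delta_mx k l) *t 1%:M + 1%:M *t V lam (delta_mx k l)) *m prt s i.
  by rewrite -tens_repE; apply: eqP'.
have pFp : type_proj (V lam) s *m prt s i *m type_proj (V lam) s = prt s i.
  by rewrite (type_proj_pr hwV hpr ri) (pr_type_proj hwV hpr ri).
have := ptranspose_casimir (i_sqr R) (two_neq0 R) eqF BF pFp.
rewrite -twistE (ptrace_pr hwV hpr ri hV'); set c := _ / _.
have -> : summand_proj 'i%C n (~~ s) *t c%:M =
    c *: type_proj (V lam) (~~ s) :> 'M[C]_(rdim TV).
  by rewrite -scalemx1 tensmxZr.
move=> /(congr1 (mulmx^~ (prt (~~ s) j))) /=.
have Bj := hb rj; rewrite (conformal_weight_opE _ hX) in Bj.
rewrite -mulmxA Bj -scalemxAr mulmxBl -!scalemxAl (type_proj_pr hwV hpr rj) => E.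
have {}E : (b (tangent_wt s i) + b (tangent_wt (~~ s) j) + n%:R) *:
      (twist (prt s i) *m prt (~~ s) j) =
    c *: prt (~~ s) j.
  by rewrite addrAC scalerDl E [LHS]addrC subrK.
have c0 : c != 0.
  have := hw_module_dim_gt0 hwV; have := hw_module_dim_gt0 hV'.
  by rewrite !lt0n => d0' d0; rewrite mulf_neq0 ?invr_neq0 // pnatr_eq0.
have D0 : b (tangent_wt s i) + b (tangent_wt (~~ s) j) + n%:R != 0.
  apply: contra_neq (pr_neq0 hwV hpr rj) => D0; move/eqP: E.
  by rewrite D0 scale0r eq_sym scaler_eq0 (negPf c0) => /eqP.
by rewrite /twist_coef -scalerA -/c -E scalerA div1r mulVf // scale1r.
Qed.

Lemma twist_pr s i : rel s i ->
  twist (prt s i) =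
    \sum_(j | `[< rel (~~ s) j >]) twist_coef s i j *: prt (~~ s) j.
Proof.
move=> ri.
have -> : twist (prt s i) = twist (prt s i) *m type_proj (V lam) (~~ s).
  rewrite {1}twistE -{1}(type_proj_pr hwV hpr ri) /type_proj ptranspose_mul1 -twistE.
  by rewrite summand_mx_tr trmx1.
rewrite -(sum_pr hwV hpr) mulmx_sumr; apply: eq_bigr => j /asboolP rj.
exact: twist_pr_mul.
Qed.

Lemma twist_pr_coef s i (tau : 'I_n -> C) : rel s i ->
  twist (prt s i) = \sum_(j | `[< rel (~~ s) j >]) tau j *: prt (~~ s) j <->
  forall j, rel (~~ s) j -> tau j = twist_coef s i j.
Proof.
move=> ri; rewrite (twist_pr ri); split=> [/esym/(pr_lin_indep hwV hpr) // | tauE].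
by apply: eq_bigr => j /asboolP/tauE ->.
Qed.

End Twist.

Theorem theorem5p2 (R : realType) (n : nat)
  (V : 'rV[int]_n -> glrep R n)
  (hV : forall kappa, dominant kappa -> hw_module (V kappa) kappa)
  (lam : 'rV[int]_n) (hlam : dominant lam)
  (pr : 'rV[int]_n -> 'M[R[i]]_(rdim (tens_rep (tangent_rep R n) (V lam))))
  (hpr : forall e, relevant (V lam) lam e ->
     invariant_projection (lam + e) (pr e))
  (X : (n * n).-tuple 'M[R[i]]_n) (hX : orthonormal_basis X)
  (b : 'rV[int]_n -> R[i])
  (hb : forall e, relevant (V lam) lam e ->
     conformal_weight_op (V lam) X *m pr e = b e *: pr e) :
  (forall k : 'I_n, relevant (V lam) lam (- eps k) ->
   forall tau : 'I_n -> R[i],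
     twist (pr (- eps k)) =
       \sum_(j < n | `[< relevant (V lam) lam (eps j) >]) tau j *: pr (eps j)
     <->
     forall j, relevant (V lam) lam (eps j) ->
       tau j = 1 / (b (- eps k) + b (eps j) + n%:R) *
               ((rdim (V (lam - eps k)))%:R / (rdim (V lam))%:R)) /\
  (forall k : 'I_n, relevant (V lam) lam (eps k) ->
   forall tau : 'I_n -> R[i],
     twist (pr (eps k)) =
       \sum_(j < n | `[< relevant (V lam) lam (- eps j) >]) tau j *: pr (- eps j)
     <->
     forall j, relevant (V lam) lam (- eps j) ->
       tau j = 1 / (b (eps k) + b (- eps j) + n%:R) *
               ((rdim (V (lam + eps k)))%:R / (rdim (V lam))%:R)).
Proof.
split=> k rk tau.
  exact: (twist_pr_coef hV hlam hpr hX hb (s := false)).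
exact: (twist_pr_coef hV hlam hpr hX hb (s := true)).
Qed.
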